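(* Let $u_-<u_+$, $\kappa>0$, $L:=u_+-u_-$, $\eta:=4\kappa^3L$, and let $q,V$ be the functions on $[u_-,u_+]$ defined in the context. There exists a constant $c_{\kappa,L}>0$, depending only on $\kappa$ and $L$, such that for any $\Phi\in L^2(u_-,u_+)$ satisfying $$q^{1/2}\Phi_y\in L^2(u_-,u_+),\quad q^{3/2}\Phi_{yy}\in L^2(u_-,u_+),$$ we have $$\int_{u_-}^{u_+}q^3\Phi_{yy}^2\,dy+\int_{u_-}^{u_+}V\Phi^2\,dy+\eta\left(\int_{u_-}^{u_+}\Phi\,dy\right)^2\ \ge\ c_{\kappa,L}\left(\int_{u_-}^{u_+}q\,\Phi_y^2\,dy+\left(\int_{u_-}^{u_+}\Phi\,dy\right)^2\right).$$ Moreover, there exists a constant $C_{\kappa,L}>0$, depending only on $\kappa$ and $L$, such that for any such $\Phi$ $$\int_{u_-}^{u_+}\Phi^2\,dy\le C_{\kappa,L}\left(\int_{u_-}^{u_+}q\,\Phi_y^2\,dy+\left(\int_{u_-}^{u_+}\Phi\,dy\right)^2\right).$$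
   Context: Here $B(y):=\kappa^2(u_-+u_+-2y)(y-u_-)(u_+-y)$, and for $y\in(u_-,u_+)$ $$q(y):=\kappa(y-u_-)(u_+-y),\qquad V(y):=-\frac{B''(y)B(y)+B'''(y)q(y)^2}{2q(y)},$$ where $V$ is understood as its continuous extension to $[u_-,u_+]$. Derivatives $\Phi_y,\Phi_{yy}$ are in the sense of distributions on $(u_-,u_+)$. *)

(* Defs.v *)
From HB Require Import structures.
From mathcomp Require Import all_boot all_order all_algebra.
From mathcomp Require Import all_classical all_reals all_analysis.

Set Implicit Arguments.
Unset Strict Implicit.
Unset Printing Implicit Defensive.

Import Order.TTheory GRing.Theory Num.Theory.
Import numFieldNormedType.Exports.

Local Open Scope classical_set_scope.
Local Open Scope ring_scope.

Section Profiles.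
Variable R : realType.
Implicit Types kappa um up y : R.

Definition B kappa um up : R -> R :=
  fun y => kappa ^+ 2 * (um + up - 2 * y) * (y - um) * (up - y).

Definition q kappa um up : R -> R := fun y => kappa * (y - um) * (up - y).

Definition V_int kappa um up : R -> R := fun y =>
  - ((derive1n 2 (B kappa um up) y * B kappa um up y +
      derive1n 3 (B kappa um up) y * q kappa um up y ^+ 2) /
     (2 * q kappa um up y)).

(* At um and up the quotient in V_int reads x / 0 = 0, so V takes there the
   limit from inside the interval. *)
Definition V kappa um up : R -> R := fun y =>
  if y \in `]um, up[ then V_int kappa um up y
  else lim (V_int kappa um up x @[x --> within `]um, up[ (nbhs y)]).

End Profiles.

Section Distributions.
Variable R : realType.
Implicit Types (a b : R) (f g phi : R -> R) (T : (R -> R) -> R).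

Local Notation mu := (@lebesgue_measure R).

(* f is defined on all of R, but only its values on ]a, b[ matter; the usual
   representatives of an L^2 class are taken Borel measurable. *)
Definition L2 a b f : Prop := (f \_ `]a, b[) \in Lfun mu 2%:E.

Definition test_function a b phi : Prop :=
  [/\ forall (n : nat) (x : R), derivable (derive1n n phi) x 1,
      compact (closure [set x | phi x != 0]) &
      closure [set x | phi x != 0] `<=` `]a, b[].

(* Distributions on ]a, b[ are represented by functionals on R -> R, of which
   only the values at test functions matter. *)
Definition distr_of a b f : (R -> R) -> R :=
  fun phi => \int[mu]_(y in `]a, b[) (f y * phi y).

Definition distr_deriv T : (R -> R) -> R := fun phi => - T (derive1 phi).

Definition represented_by a b T g : Prop :=
  locally_integrable `]a, b[ g /\
  forall phi, test_function a b phi -> T phi = distr_of a b g phi.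

(* Since q is smooth and positive on ]um, up[, a distribution T such that
   q^s T is in L^2 is itself a locally integrable function; hence Phi_y and
   Phi_yy below are functions representing the distributional derivatives. *)
Definition admissible kappa um up (Phi Phi_y Phi_yy : R -> R) : Prop :=
  [/\ L2 um up Phi,
      represented_by um up (distr_deriv (distr_of um up Phi)) Phi_y,
      represented_by um up
        (distr_deriv (distr_deriv (distr_of um up Phi))) Phi_yy,
      L2 um up (fun y => q kappa um up y `^ (1 / 2) * Phi_y y) &
      L2 um up (fun y => q kappa um up y `^ (3 / 2) * Phi_yy y)].

End Distributions.

(* Main.v *)
(** Let m be the midpoint of (u_-, u_+), l = L/2, p = y - m, w = l^2 - p^2, so
    that q = kappa w and V = 6 kappa^3 (3 p^2 - l^2).  Integration by parts gives

      int w ((w Phi')' + 3 Phi)^2 = int w^3 Phi''^2 + 6 int (3 p^2 - l^2) Phi^2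
                                     - 4 l^2 int w Phi'^2 + 9 int w Phi^2.

    The square is dropped, and 9 int w Phi^2 is absorbed by a weighted Poincare
    inequality, int w (Phi - Phi(m))^2 <= (4/11) l^2 int w Phi'^2, obtained by
    completing a square with a Riccati multiplier on each side of m.  The mean
    int w Phi is compared with int Phi through the identity
    int (3 p^2 - l^2) Phi = int p w Phi' and Cauchy-Schwarz.

    All integrations by parts are done on compact subintervals; the boundary
    terms vanish in the limit because Phi in L^2 forces w Phi^2 -> 0 along
    some points tending to each endpoint (1/w is not integrable there).

    A function with a locally integrable weak derivative is a.e. a primitive of
    it: test against smooth approximations of the indicator of [a, b], whose
    derivatives are approximate identities at a and b, and let a, b be Lebesgue
    points. *)

Require Import Defs.
From HB Require Import structures.
From mathcomp Require Import all_boot all_order all_algebra.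
From mathcomp Require Import all_classical all_reals all_analysis.
From mathcomp Require Import measurable_realfun.
From mathcomp Require Import ring lra.
Import Order.TTheory GRing.Theory Num.Theory.
Import numFieldNormedType.Exports.
Local Open Scope classical_set_scope.
Local Open Scope ring_scope.

(** * Absolutely continuous functions *)

Section absolutely_continuous.
Set Implicit Arguments.
Unset Strict Implicit.
Context {R : realType}.
Local Notation mu := (@lebesgue_measure R).
Implicit Types (F G f g h : R -> R) (s t x y z e r d : R).

(** The coefficient 3 in the square is forced. Expanding int w ((w Phi')' + c Phi)^2 leaves a term
    (6 - 2c) int w^2 Phi'^2, which c = 3 removes, and the cross term then contributes exactly int V
    Phi^2 / kappa^3. As [V] changes sign and has integral zero, constants are seen by the mean term
    alone, so the mean must be carried through every estimate.

    The budget, for kappa = 1: without the square, 4 l^2 int w Phi'^2 has to pay for 9 int w Phi^2.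
    The Poincare inequality and the comparison of the two means bound the latter by (36/11 + 2/5)
    l^2 int w Phi'^2 + 6 l (int Phi)^2. The first coefficient is below 37/10, which leaves 3/10; the
    second is below the 8 l that eta supplies, which leaves 2 l. Any Poincare constant above 5/2 in
    place of 11/4 would fit, which is why a simple bounded multiplier is good enough.

    The boundary terms of the second-order identity also contain Phi', which the limiting argument
    does not track; they are discarded by their sign near the endpoints. *)

Lemma integrable_fctD (D : set R) f g : measurable D ->
  mu.-integrable D (EFin \o f) -> mu.-integrable D (EFin \o g) ->
  mu.-integrable D (EFin \o (fun x => f x + g x)).
Proof. by move=> mD fi gi; exact: (@integrableD _ _ _ mu D mD _ _ fi gi). Qed.

Lemma integrable_fctB (D : set R) f g : measurable D ->
  mu.-integrable D (EFin \o f) -> mu.-integrable D (EFin \o g) ->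
  mu.-integrable D (EFin \o (fun x => f x - g x)).
Proof. by move=> mD fi gi; exact: (@integrableB _ _ _ mu D mD _ _ fi gi). Qed.

Lemma integrable_fctZ (D : set R) (k : R) f : measurable D ->
  mu.-integrable D (EFin \o f) ->
  mu.-integrable D (EFin \o (fun x => k * f x)).
Proof. by move=> mD fi; exact: (@integrableZl _ _ _ mu D mD k _ fi). Qed.

Lemma integrable_cst_oo s t (k : R) : mu.-integrable `]s, t[ (EFin \o cst k).
Proof.
apply: (@integrableS _ _ _ mu `[s, t]) => //; first exact: subset_itv_oo_cc.
apply: continuous_compact_integrable; first exact: segment_compact.
by move=> x; exact: cvg_cst.
Qed.

Lemma lebesgue_measure_cc x y : x <= y -> mu `[x, y]%classic = (y - x)%:E.
Proof.
rewrite lebesgue_measure_itv/= lte_fin le_eqVlt => /predU1P[->|->].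
  by rewrite ltxx subrr.
by rewrite EFinB.
Qed.

Lemma integrable_subitv s t x y f :
  mu.-integrable `[s, t] (EFin \o f) -> s <= x -> y <= t ->
  mu.-integrable `[x, y] (EFin \o f).
Proof.
move=> fi sx yt; apply: integrableS fi => //.
by apply: subset_itvScc; rewrite bnd_simp.
Qed.

Lemma Rintegral_chasles x y z f : x <= y -> y <= z ->
  mu.-integrable `[x, z] (EFin \o f) ->
  \int[mu]_(u in `[x, z]) f u =
  \int[mu]_(u in `[x, y]) f u + \int[mu]_(u in `[y, z]) f u.
Proof.
move=> xy yz fi; apply/eqP; rewrite addrC -subr_eq; apply/eqP.
rewrite (@Rintegral_itvB _ f (BLeft x) (BRight z) y)//.
apply: Rintegral_itv_obnd_cbnd; apply: integrableS fi => //.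
by apply: subset_itvr; rewrite bnd_simp.
Qed.

Lemma within_continuous_integrableM s t F g :
  {within `[s, t], continuous F} -> mu.-integrable `[s, t] (EFin \o g) ->
  mu.-integrable `[s, t] (EFin \o (fun x => F x * g x)).
Proof.
move=> cF gi.
rewrite (_ : EFin \o _ = (EFin \o F) \* (EFin \o g))%E; last first.
  by apply/funext => x /=; rewrite EFinM.
apply: integrableMr => //.
  by apply: subspace_continuous_measurable_fun.
have /compact_bounded[M [_ mrt]] :=
  continuous_compact cF (@segment_compact _ s t).
by exists M; split; rewrite ?num_real // => ? ? ? ?; exact: mrt.
Qed.

(** Absolute continuity in integral form, with the derivative carried as explicit data: [f] only has
    to be integrable, which is all that a weak derivative offers. With the closure under sums and
    products below, each integration by parts reduces to a polynomial identity checked by [ring]. *)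
Definition abscont s t F f : Prop :=
  mu.-integrable `[s, t] (EFin \o f) /\
  forall x y, s <= x -> x <= y -> y <= t ->
    F y - F x = \int[mu]_(z in `[x, y]) f z.

Lemma eq_abscont s t F G f g :
  (forall x, s <= x <= t -> F x = G x) ->
  (forall x, s <= x <= t -> f x = g x) ->
  abscont s t F f -> abscont s t G g.
Proof.
move=> FG fg [fi Ff]; split.
  apply: eq_integrable fi => // x; rewrite inE/= in_itv/= => xst.
  by rewrite fg.
move=> x y sx xy yt; rewrite -!FG; last 2 first.
- by rewrite sx (le_trans xy).
- by rewrite yt (le_trans sx).
rewrite Ff//; apply: eq_Rintegral => z; rewrite inE/= in_itv/= => /andP[xz zy].
by rewrite fg// (le_trans sx)//= (le_trans zy).
Qed.

Lemma abscont_continuous s t F f : s <= t -> abscont s t F f ->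
  {within `[s, t], continuous F}.
Proof.
move=> st [fi Ff].
have cI := @parameterized_integral_continuous R s t f st fi.
have : {within `[s, t], continuous
    (fun x => F s + \int[mu]_(z in `[s, x]) f z)}.
  by move=> x; apply: (@cvgD _ R^o); [exact: cvg_cst|exact: cI].
apply: subspace_eq_continuous => x; rewrite inE/= in_itv/= => /andP[sx xt].
rewrite -[RHS]/(F x) -[RHS](subrKC (F s)); congr (_ + _); exact/esym/Ff.
Qed.

Lemma abscontD s t F G f g : abscont s t F f -> abscont s t G g ->
  abscont s t (fun x => F x + G x) (fun x => f x + g x).
Proof.
move=> [fi Ff] [gi Gg]; split; first exact: integrable_fctD.
move=> x y sx xy yt; rewrite RintegralD//.
- by rewrite -Ff// -Gg//; ring.
- exact: integrable_subitv fi sx yt.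
- exact: integrable_subitv gi sx yt.
Qed.

Lemma abscont_cst s t (c : R) : abscont s t (fun=> c) (fun=> 0).
Proof.
split; first exact: integrable0.
by move=> x y _ _ _; rewrite Rintegral_cst// mul0r subrr.
Qed.

Lemma is_derive_abscont s t F f : {within `[s, t], continuous f} ->
  (forall x, s <= x <= t -> is_derive x 1 F (f x)) -> abscont s t F f.
Proof.
move=> cf dF; split.
  by apply: continuous_compact_integrable => //; exact: segment_compact.
move=> x y sx; rewrite le_eqVlt => /predU1P[<- _|xy yt].
  by rewrite set_itv1 Rintegral_set1 subrr.
have cF z : s <= z <= t -> {for z, continuous F}.
  move=> zst; apply/differentiable_continuous/derivable1_diffP.
  by have [] := dF z zst.
rewrite /Rintegral (@continuous_FTC2 _ f F)//=.
- by apply: continuous_subspaceW cf; apply: subset_itvScc; rewrite bnd_simp.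
- split=> [z||].
  + rewrite in_itv/= => /andP[xz zy].
    have /dF[] // : s <= z <= t.
    by rewrite (le_trans sx (ltW xz)) (le_trans (ltW zy)).
  + apply: cvg_at_right_filter; apply: cF; rewrite sx/=.
    by rewrite (le_trans (ltW xy)).
  + apply: cvg_at_left_filter; apply: cF; rewrite yt andbT.
    by rewrite (le_trans _ (ltW xy)).
- move=> z; rewrite in_itv/= => /andP[xz zy].
  rewrite derive1E; have /dF[] // : s <= z <= t.
  by rewrite (le_trans sx (ltW xz)) (le_trans (ltW zy)).
Qed.

Lemma abscont_uniform s t F f : abscont s t F f -> forall e, 0 < e ->
  exists2 d, 0 < d & forall x y, s <= x -> x <= y -> y <= t -> y - x < d ->
    `|F y - F x| <= e.
Proof.
move=> [fi Ff] e e0; pose f0 := f \_ `[s, t].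
have f0i : mu.-integrable setT (EFin \o f0).
  by rewrite -restrict_EFin; apply/integrable_restrict => //=; rewrite setTI.
have [d [d0 Hd]] := @integral_normr_continuous _ _ _ mu f0 f0i e e0.
exists d => // x y sx xy yt yxd; rewrite Ff//.
have fxy := integrable_subitv fi sx yt.
apply: (le_trans (le_normr_Rintegral _ fxy)) => //.
rewrite (_ : \int[mu]_(z in _) _ = \int[mu]_(z in `[x, y]) `|f0 z|).
  apply/ltW/Hd => //.
  rewrite [X in (X < _)%E](_ : _ = (y - x)%:E) ?lte_fin//.
  exact: lebesgue_measure_cc.
apply: eq_Rintegral => z; rewrite inE/= in_itv/= => /andP[xz zy].
by rewrite /f0 patchE ifT// inE/= in_itv/= (le_trans sx)//= (le_trans zy).
Qed.

(* The defect of the product rule is additive over adjacent intervals and is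
   o(1) times a finite measure on short ones, so it vanishes. *)
Lemma abscontM s t F G f g : abscont s t F f -> abscont s t G g ->
  abscont s t (fun x => F x * G x) (fun x => f x * G x + F x * g x).
Proof.
have [ts|st] := ltP t s.
  move=> _ _; split; first by rewrite set_itv_ge ?bnd_simp -?ltNge//;
    exact: integrable_set0.
  move=> x y sx xy yt; exfalso; have := le_lt_trans (le_trans (le_trans sx xy) yt) ts.
  by rewrite ltxx.
move=> Ff Gg; have cF := abscont_continuous st Ff.
have cG := abscont_continuous st Gg.
have [fi FE] := Ff; have [gi GE] := Gg.
have fGi : mu.-integrable `[s, t] (EFin \o (fun x => f x * G x)).
  have := within_continuous_integrableM cG fi.
  by apply: eq_integrable => // x _ /=; rewrite mulrC.
have Fgi := within_continuous_integrableM cF gi.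
pose k x := f x * G x + F x * g x.
have ki : mu.-integrable `[s, t] (EFin \o k) by exact: integrable_fctD.
pose n x := `|f x| + `|g x|.
have ni : mu.-integrable `[s, t] (EFin \o n).
  by apply: integrable_fctD => //; exact: integrable_norm.
split=> // x y sx xy yt.
pose e a b := F b * G b - F a * G a - \int[mu]_(z in `[a, b]) k z.
suff : e x y = 0 by move=> /eqP; rewrite subr_eq0 => /eqP.
have e_add a b c : s <= a -> a <= b -> b <= c -> c <= t -> e a c = e a b + e b c.
  move=> sa ab bc ct; rewrite /e (Rintegral_chasles ab bc)//; first by ring.
  exact: integrable_subitv ki sa ct.
have e_small r : 0 < r -> exists2 d, 0 < d & forall a b, s <= a -> a <= b ->
    b <= t -> b - a < d -> `|e a b| <= r * \int[mu]_(z in `[a, b]) n z.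
  move=> r0; have [d1 d10 H1] := abscont_uniform Ff r0.
  have [d2 d20 H2] := abscont_uniform Gg r0.
  exists (Num.min d1 d2); first by rewrite lt_min d10.
  move=> a b sa ab bt; rewrite lt_min => /andP[bad1 bad2].
  have sub h : mu.-integrable `[s, t] (EFin \o h) ->
      mu.-integrable `[a, b] (EFin \o h).
    by move=> hi; exact: integrable_subitv hi sa bt.
  (* The factors are frozen at opposite ends, [G] at [b] and [F] at [a], because then G b (F b - F
     a) + F a (G b - G a) is exactly the increment of the product. *)
  have -> : e a b = \int[mu]_(z in `[a, b])
      ((G b * f z + F a * g z) - k z).
    rewrite RintegralB//; last 2 first.
    - by apply: integrable_fctD => //; apply: integrable_fctZ => //; exact: sub.
    - exact: sub.
    rewrite RintegralD//; last 2 first.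
    - by apply: integrable_fctZ => //; exact: sub.
    - by apply: integrable_fctZ => //; exact: sub.
    rewrite !RintegralZl//; [|exact: sub|exact: sub].
    by rewrite -FE// -GE// /e; ring.
  have di : mu.-integrable `[a, b]
      (EFin \o (fun z => (G b * f z + F a * g z) - k z)).
    apply: integrable_fctB => //; last exact: sub.
    by apply: integrable_fctD => //; apply: integrable_fctZ => //; exact: sub.
  apply: (le_trans (le_normr_Rintegral _ di)) => //.
  rewrite -RintegralZl//; last exact: sub.
  apply: le_Rintegral => //.
  - exact: integrable_norm.
  - by apply: integrable_fctZ => //; exact: sub.
  move=> z /=; rewrite in_itv/= => /andP[az zb].
  have -> : G b * f z + F a * g z - k z =
     (G b - G z) * f z - (F z - F a) * g z by rewrite /k; ring.
  apply: (le_trans (ler_normB _ _)); rewrite !normrM /n mulrDr.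
  apply: lerD; apply: ler_wpM2r => //.
  - apply: H2 => //; first exact: le_trans az.
    by apply: le_lt_trans bad2; rewrite lerB.
  - apply: H1 => //; first exact: le_trans bt.
    by apply: le_lt_trans bad1; rewrite lerB.
have n_ge0 a b : 0 <= \int[mu]_(z in `[a, b]) n z.
  by apply: Rintegral_ge0 => z _; rewrite addr_ge0.
have key r : 0 < r -> `|e x y| <= r * \int[mu]_(z in `[x, y]) n z.
  move=> /e_small[d d0 Hd].
  have [N] : exists N : nat, (y - x) / d < N%:R.
    by exists (Num.bound ((y - x) / d)); apply: archi_boundP;
      rewrite divr_ge0 ?subr_ge0// ltW.
  rewrite ltr_pdivrMr// => HN.
  have N0 : (0 < N)%N.
    case: N HN => //; rewrite mul0r subr_lt0 => /(le_lt_trans xy).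
    by rewrite ltxx.
  pose a i := x + i%:R * ((y - x) / N%:R).
  have step_ge0 : 0 <= (y - x) / N%:R by rewrite divr_ge0 ?subr_ge0.
  have a_le i j : (i <= j)%N -> a i <= a j.
    by move=> ij; rewrite /a lerD2l ler_wpM2r// ler_nat.
  have a0 : a 0%N = x by rewrite /a mul0r addr0.
  have aN : a N = y.
    by rewrite /a mulrCA divff ?mulr1 ?pnatr_eq0 -?lt0n//; ring.
  have ax i : x <= a i by rewrite -a0 a_le.
  have a_y i : (i <= N)%N -> a i <= y by rewrite -aN; exact: a_le.
  suff : forall i, (i <= N)%N ->
      `|e x (a i)| <= r * \int[mu]_(z in `[x, a i]) n z.
    by move=> /(_ N (leqnn N)); rewrite aN.
  elim=> [_|i IH iN].
    by rewrite a0 /e set_itv1 !Rintegral_set1 mulr0 subr0 subrr normr0.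
  have xai := ax i; have aiai1 : a i <= a i.+1 by exact: a_le.
  have ai1t : a i.+1 <= t by rewrite (le_trans (a_y _ iN)).
  rewrite (e_add x (a i))//.
  rewrite (Rintegral_chasles xai aiai1)//; last exact: integrable_subitv ni sx ai1t.
  rewrite mulrDr; apply: (le_trans (ler_normD _ _)); apply: lerD.
    exact: IH (ltnW iN).
  apply: Hd => //; first exact: le_trans xai.
  rewrite /a; have -> : x + i.+1%:R * ((y - x) / N%:R) -
    (x + i%:R * ((y - x) / N%:R)) = (y - x) / N%:R by rewrite -natr1; ring.
  by rewrite ltr_pdivrMr ?ltr0n// mulrC.
apply/eqP; rewrite -normr_le0; apply/ler_addgt0Pl => r r0; rewrite addr0.
have I0 := n_ge0 x y; set I := \int[mu]_(z in `[x, y]) n z in key I0.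
have := key (r / (I + 1)) (divr_gt0 r0 (ltr_wpDl I0 ltr01)).
move=> /le_trans; apply.
rewrite mulrAC ler_pdivrMr ?ltr_wpDl//.
by apply: ler_wpM2l; [exact: ltW|rewrite lerDl].
Qed.

End absolutely_continuous.

(** * A smooth step function *)

Section smooth_step.
Set Implicit Arguments.
Unset Strict Implicit.
Context {R : realType}.
Local Notation mu := (@lebesgue_measure R).
Implicit Types (f g : R -> R) (p : {poly R}) (x y e r : R).

Definition smooth f := forall (n : nat) x, derivable (derive1n n f) x 1.

(** Replaces induction on the order of differentiation: exhibiting a class that contains [f] and is
    stable under derivatives avoids Leibniz-type formulas for the n-th derivative. *)
Lemma smooth_coind (P : (R -> R) -> Prop) :
  (forall f, P f -> exists2 g, P g & forall x, is_derive x 1 f (g x)) ->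
  forall f, P f -> smooth f.
Proof.
move=> HP; have d1 f : P f -> P (derive1 f).
  move=> /HP[g Pg dg]; rewrite (_ : derive1 f = g)//; apply/funext => x.
  by rewrite derive1E; have [] := dg x.
move=> f Pf n; have : P (derive1n n f).
  by elim: n => [//|n IH]; rewrite derive1nS; exact: d1.
by move=> /HP[g _ dg] x; have [] := dg x.
Qed.

Lemma smooth_is_derive f x : smooth f -> is_derive x 1 f (derive1 f x).
Proof. by move=> /(_ 0%N x) df; rewrite derive1E; exact: derivableP. Qed.

Lemma smooth_derive1 f : smooth f -> smooth (derive1 f).
Proof. by move=> sf n x; have := sf n.+1 x; rewrite derive1Sn. Qed.

Lemma smooth_primitive f g :
  smooth g -> (forall x, is_derive x 1 f (g x)) -> smooth f.
Proof.
move=> sg dfg [|n] x; first by have [] := dfg x.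
rewrite derive1Sn (_ : derive1 f = g)//; apply/funext => y.
by rewrite derive1E; have [] := dfg y.
Qed.

Lemma smooth_continuous f : smooth f -> continuous f.
Proof.
move=> sf x; apply/differentiable_continuous/derivable1_diffP.
exact: sf 0%N x.
Qed.

(** The invariant for [smooth_coind]: single products are not stable under differentiation, but by
    the product rule their finite sums are. *)
Inductive sum_of_smooth_products : (R -> R) -> Prop :=
| Smooth_product f g : smooth f -> smooth g ->
    sum_of_smooth_products (fun x => f x * g x)
| Smooth_sum f g : sum_of_smooth_products f -> sum_of_smooth_products g ->
    sum_of_smooth_products (fun x => f x + g x).

Lemma smoothM f g : smooth f -> smooth g -> smooth (fun x => f x * g x).
Proof.
move=> sf sg; apply: (smooth_coind (P := sum_of_smooth_products)) => [h|].
  elim=> {h f g sf sg} [f g sf sg|f g _ [f' Pf' df] _ [g' Pg' dg]].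
    exists (fun x => derive1 f x * g x + f x * derive1 g x).
      apply: Smooth_sum.
        exact: Smooth_product (smooth_derive1 sf) sg.
      exact: Smooth_product sf (smooth_derive1 sg).
    move=> x; have df := smooth_is_derive x sf.
    have dg := smooth_is_derive x sg.
    apply: is_derive_eq (is_deriveM df dg) _.
    by rewrite /GRing.scale /=; ring.
  by exists (fun x => f' x + g' x); [exact: Smooth_sum|move=> x; exact: is_deriveD].
exact: Smooth_product.
Qed.

Lemma smoothB f g : smooth f -> smooth g -> smooth (fun x => f x - g x).
Proof.
move=> sf sg; pose P h := exists f g, [/\ smooth f, smooth g &
  h = (fun x => f x - g x)].
apply: (smooth_coind (P := P)); last by exists f, g.
move=> _ [{}f [{}g [{}sf {}sg ->]]].
exists (fun x => derive1 f x - derive1 g x).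
  exists (derive1 f), (derive1 g).
  by split; [exact: smooth_derive1|exact: smooth_derive1|].
by move=> x; apply: is_deriveB; exact: smooth_is_derive.
Qed.

Lemma is_derive_affine a b x : is_derive x 1 (fun y : R => a * y + b) a.
Proof.
apply: is_derive_eq
  (is_deriveD (is_deriveZ a (is_derive_id x (1 : R))) (is_derive_cst b x 1)) _.
by rewrite addr0 /GRing.scale /= mulr1.
Qed.

Lemma smooth_affine f a b : smooth f -> smooth (fun x => f (a * x + b)).
Proof.
move=> sf; pose P h := exists k f, smooth f /\ h = (fun x => k * f (a * x + b)).
apply: (smooth_coind (P := P)); last first.
  by exists 1, f; split=> //; apply/funext => x; rewrite mul1r.
move=> _ [k [{}f [{}sf ->]]]; exists (fun x => (k * a) * (derive1 f) (a * x + b)).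
  by exists (k * a), (derive1 f); split; [exact: smooth_derive1|].
move=> x; have df := smooth_is_derive (a * x + b) sf.
have := @is_derive1_comp R f (fun y => a * y + b) x _ _ df (is_derive_affine a b x).
move=> H; apply: is_derive_eq (is_deriveZ k H) _.
by rewrite /GRing.scale/=; ring.
Qed.

(** The classical flat function exp(-1/x); the polynomial factor in 1/x makes the family stable
    under differentiation. *)
Definition flat p x : R := if x <= 0 then 0 else p.[x^-1] * expR (- x^-1).

(** With t = 1/x, a polynomial of size A t^n is beaten by exp t >= t^(n+2) / (n+2)!. The two spare
    powers of t give the quadratic decay from which the derivative at 0 is read off. *)
Lemma flat_bound p : exists2 C, 0 <= C &
  forall x, `|x| <= 1 -> `|flat p x| <= C * x ^+ 2.
Proof.
have [n [A A0 HA]] : exists n : nat, exists2 A : R, 0 <= A &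
    forall t, 1 <= t -> `|p.[t]| <= A * t ^+ n.
  elim/poly_ind: p => [|p c [n [A A0 HA]]].
    by exists 0%N, 0 => // t _; rewrite horner0 normr0 mul0r.
  exists n.+1, (A + `|c|); first by rewrite addr_ge0.
  move=> t t1; have t0 : 0 <= t by rewrite (le_trans _ t1).
  rewrite !hornerE (le_trans (ler_normD _ _))// mulrDl lerD//.
    by rewrite normrM (ger0_norm t0) exprSr mulrA ler_wpM2r// HA.
  by rewrite ler_peMr// exprn_ege1.
exists (A * (n.+2)`!%:R); first by rewrite mulr_ge0.
move=> x; rewrite ler_norml => /andP[_ x1]; rewrite /flat.
case: (leP x 0) => x0; first by rewrite normr0 mulr_ge0 ?sqr_ge0// mulr_ge0.
have t1 : 1 <= x^-1 by rewrite invf_ge1.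
have t0 : 0 < x^-1 by rewrite invr_gt0.
rewrite normrM (ger0_norm (expR_ge0 _)) expRN.
have -> : x ^+ 2 = (x^-1) ^- 2 by rewrite exprVn invrK.
move: (x^-1) t1 t0 => t t1 t0.
rewrite ler_pdivrMr ?expR_gt0// mulrAC ler_pdivlMr ?exprn_gt0//.
apply: (@le_trans _ _ (A * t ^+ n * t ^+ 2)).
  by rewrite ler_wpM2r ?sqr_ge0// HA.
rewrite -!mulrA ler_wpM2l// -exprD addn2.
have := @expR_ge1Dxn R t n.+1 (ltW t0).
have f0 : 0 < (n.+2)`!%:R :> R by rewrite ltr0n fact_gt0.
move=> H; have : t ^+ n.+2 / (n.+2)`!%:R <= expR t.
  by apply: le_trans H; rewrite lerDr.
by rewrite ler_pdivrMr// mulrC.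
Qed.

Lemma is_derive_quadratic_bound f C : f 0 = 0 ->
  (forall x, `|x| <= 1 -> `|f x| <= C * x ^+ 2) -> is_derive (0 : R) 1 f 0.
Proof.
move=> f0 fC.
suff H : h^-1 *: ((f \o shift 0) (h *: (1 : R)) - f 0) @[h --> 0^'] --> (0 : R).
  by apply: DeriveDef; [apply/cvg_ex; exists 0|exact: cvg_lim H].
have C0 : 0 <= C.
  have := fC 1; rewrite normr1 expr1n mulr1 => /(_ (lexx _)).
  by apply: le_trans.
apply/cvgr0Pnorm_le => e e0; near=> h.
have h0 : h != 0 by near: h; exact: nbhs_dnbhs_neq.
have h1 : `|h| <= 1.
  by near: h; apply: dnbhs0_le.
have he : `|h| <= e / (C + 1).
  by near: h; apply: dnbhs0_le; rewrite divr_gt0// ltr_wpDl.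
rewrite f0 subr0 /= addr0 /GRing.scale /= mulr1 normrM normfV.
rewrite ler_pdivrMl ?normr_gt0//.
apply: (le_trans (fC h h1)); rewrite -real_normK ?num_real// expr2 mulrCA.
rewrite ler_wpM2l//.
apply: (@le_trans _ _ (C * (e / (C + 1)))); first by rewrite ler_wpM2l.
rewrite mulrA ler_pdivrMr ?ltr_wpDl// mulrC ler_wpM2l ?lerDl//.
exact: ltW.
Unshelve. all: by end_near. Qed.

(** For t = 1/x one has dt/dx = - t^2, so p(t) exp(-t) has derivative t^2 (p(t) - p'(t)) exp(-t),
    again a member of the family. *)
Lemma is_derive_flat p x :
  is_derive x 1 (flat p) (flat ('X ^+ 2 * (p - p^`())) x).
Proof.
have [x0|x0|->] := ltgtP x 0.
- rewrite [X in is_derive _ _ _ X]/flat (ltW x0).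
  have : is_derive x 1 (cst 0 : R -> R) 0 by exact: is_derive_cst.
  apply: near_eq_is_derive.
  near=> y; rewrite /flat/= ltW//; near: y; exact: lt_nbhsl.
- rewrite [X in is_derive _ _ _ X]/flat leNgt x0/=.
  have xn0 : x != 0 by rewrite gt_eqF.
  have dinv : is_derive x 1 (fun y : R => y^-1) (- x ^- 2).
    apply: DeriveDef; first by apply: (@derivableV _ _ id) => //.
    rewrite (@deriveV _ _ id)//.
    by rewrite derive_id /GRing.scale /= mulr1.
  have d1 := @is_derive1_comp R (horner p) (fun y => y^-1) x _ _
     (is_derive_poly p x^-1) dinv.
  have d2 := @is_derive1_comp R expR (fun y => - y^-1) x _ _
     (is_derive_expR (- x^-1)) (is_deriveN dinv).
  have := is_deriveM d1 d2.
  move=> H; have {}H : is_derive x 1 (fun y => p.[y^-1] * expR (- y^-1))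
      (('X ^+ 2 * (p - p^`())).[x^-1] * expR (- x^-1)).
    apply: is_derive_eq H _.
    by rewrite /GRing.scale /= hornerM hornerXn hornerD hornerN -exprVn; ring.
  apply: near_eq_is_derive H.
  near=> y; rewrite /flat leNgt.
  suff -> : 0 < y by [].
  by near: y; exact: lt_nbhsr.
- rewrite [X in is_derive _ _ _ X]/flat lexx.
  have [C C0 HC] := flat_bound p.
  by apply: is_derive_quadratic_bound HC; rewrite /flat lexx.
Unshelve. all: by end_near. Qed.

Lemma smooth_flat p : smooth (flat p).
Proof.
apply: (smooth_coind (P := fun h => exists p, h = flat p)); last by exists p.
move=> _ [{}p ->]; exists (flat ('X ^+ 2 * (p - p^`()))).
  by eexists.
by move=> x; exact: is_derive_flat.
Qed.

(** A bump on ]-1, 1[ that is deliberately left unnormalised: its mass, later [smooth_step 1], stays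
    as a positive factor and is cancelled once the limit has been taken. The arguments are spelled
    so as to match [smooth_affine]. *)
Definition mollifier x : R := flat 1 (1 * x + 1) * flat 1 (-1 * x + 1).

Lemma smooth_mollifier : smooth mollifier.
Proof. by apply: smoothM; apply: smooth_affine; exact: smooth_flat. Qed.

Lemma flat1_ge0 x : 0 <= flat 1 x.
Proof. by rewrite /flat; case: ifP => // _; rewrite hornerC mul1r expR_ge0. Qed.

Lemma mollifier_ge0 x : 0 <= mollifier x.
Proof. by rewrite mulr_ge0 ?flat1_ge0. Qed.

Lemma mollifier_gt0 x : -1 < x < 1 -> 0 < mollifier x.
Proof.
move=> /andP[x1 x2]; rewrite /mollifier /flat !leNgt.
have -> : 0 < 1 * x + 1 by lra.
have -> : 0 < -1 * x + 1 by lra.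
by rewrite /= !hornerC !mul1r mulr_gt0 ?expR_gt0.
Qed.

Lemma mollifier_out x : 1 <= `|x| -> mollifier x = 0.
Proof.
rewrite ler_normr /mollifier /flat => /orP[] x1.
  by rewrite [X in _ * X]ifT ?mulr0//; lra.
by rewrite ifT ?mul0r//; lra.
Qed.

End smooth_step.

(** * Smooth cutoffs of an interval *)

Section weak_derivative.
Set Implicit Arguments.
Unset Strict Implicit.
Context {R : realType}.
Local Notation mu := (@lebesgue_measure R).
Implicit Types (f g : R -> R) (x y a b s t e r N : R).

Lemma mollifier_le1 x : mollifier x <= 1.
Proof.
have flat_le1 y : flat 1 y <= 1.
  rewrite /flat; case: ifP => // /negbT; rewrite -ltNge => y0.
  by rewrite hornerC mul1r expR_le1 oppr_le0 invr_ge0 ltW.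
by rewrite mulr_ile1 ?flat1_ge0.
Qed.

Lemma integrable_mollifier (D : set R) : measurable D ->
  mu.-integrable D (EFin \o mollifier).
Proof.
move=> mD; suff : mu.-integrable setT (EFin \o (@mollifier R)).
  by apply: integrableS.
have -> : EFin \o (@mollifier R) = (EFin \o (@mollifier R)) \_ `[-1, 1].
  apply/funext => x; rewrite patchE; case: ifPn => // /negP xI /=.
  rewrite mollifier_out// leNgt; apply/negP => x1; apply: xI.
  by rewrite inE/= in_itv/=; move: x1; rewrite ltr_norml => /andP[/ltW-> /ltW->].
apply/(@integrable_mkcond _ _ _ mu `[-1, 1]) => //.
apply: continuous_compact_integrable; first exact: segment_compact.
by apply: continuous_subspaceT; exact/smooth_continuous/smooth_mollifier.
Qed.

Definition smooth_step x := \int[mu]_(z in `]-oo, x]) mollifier z.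

Lemma is_derive_smooth_step x : is_derive x 1 smooth_step (mollifier x).
Proof.
have [||||dS SE] := @continuous_FTC1 R mollifier -oo%O x (x + 1).
- by rewrite ltrDl.
- exact: integrable_mollifier.
- by rewrite ltNyr.
- exact/smooth_continuous/smooth_mollifier.
by apply: DeriveDef; [exact: dS|rewrite -derive1E].
Qed.

Lemma smooth_smooth_step : smooth smooth_step.
Proof. by apply: smooth_primitive is_derive_smooth_step; exact: smooth_mollifier. Qed.

Lemma abscont_smooth_step s t : abscont s t smooth_step mollifier.
Proof.
apply: is_derive_abscont => [|x _]; last exact: is_derive_smooth_step.
by apply: continuous_subspaceT; exact/smooth_continuous/smooth_mollifier.
Qed.

Lemma smooth_step_nd x y : x <= y -> smooth_step x <= smooth_step y.
Proof.
move=> xy; have [_ /(_ x y (lexx _) xy (lexx _))] := abscont_smooth_step x y.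
by rewrite -subr_ge0 => ->; apply: Rintegral_ge0 => z _; exact: mollifier_ge0.
Qed.

Lemma smooth_step_left x : x <= -1 -> smooth_step x = 0.
Proof.
move=> x1.
rewrite /smooth_step (@eq_Rintegral _ _ _ mu _ (cst 0)) ?Rintegral_cst ?mul0r// => z.
rewrite inE/= in_itv/= => zx; apply: mollifier_out.
by rewrite ler_normr; apply/orP; right; lra.
Qed.

Lemma smooth_step_right x : 1 <= x -> smooth_step x = smooth_step 1.
Proof.
move=> x1; apply/eqP; rewrite -subr_eq0.
have [_ /(_ 1 x (lexx _) x1 (lexx _))->] := abscont_smooth_step 1 x.
rewrite (@eq_Rintegral _ _ _ mu _ (cst 0)) ?Rintegral_cst ?mul0r// => z.
rewrite inE/= in_itv/= => /andP[z1 _]; apply: mollifier_out.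
by rewrite ler_normr z1.
Qed.

Lemma smooth_step1_gt0 : 0 < smooth_step 1.
Proof.
rewrite -(@smooth_step_left (-1))//.
apply: (@gtr0_derive1_incr _ smooth_step (-1) 1) => //.
- by move=> x _; have [] := is_derive_smooth_step x.
- move=> x; rewrite in_itv/= => /mollifier_gt0; rewrite derive1E.
  by have [_ ->] := is_derive_smooth_step x.
- by apply: continuous_subspaceT; exact/smooth_continuous/smooth_smooth_step.
Qed.

Lemma smooth_step_ge0 x : 0 <= smooth_step x.
Proof. by apply: Rintegral_ge0 => z _; exact: mollifier_ge0. Qed.

Lemma smooth_step_le1 x : smooth_step x <= smooth_step 1.
Proof.
have [x1|/ltW/smooth_step_nd//] := leP 1 x; by rewrite smooth_step_right.
Qed.

Definition mollifier_at a N x := N * mollifier (N * x + (- (N * a))).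

(** The indicator of [a, b] smoothed at scale 1/N and multiplied by the mass [smooth_step 1]. *)
Definition cutoff a b N x :=
  smooth_step (N * x + (- (N * a))) - smooth_step (N * x + (- (N * b))).

Lemma is_derive_smooth_step_affine a N x :
  is_derive x 1 (fun x => smooth_step (N * x + (- (N * a)))) (mollifier_at a N x).
Proof.
have := @is_derive1_comp R smooth_step (fun y => N * y + (- (N * a))) x _ _
  (is_derive_smooth_step _) (is_derive_affine N (- (N * a)) x).
by move=> H; apply: is_derive_eq H _; exact: mulrC.
Qed.

Lemma continuous_mollifier_at a N : continuous (mollifier_at a N).
Proof.
rewrite (_ : mollifier_at a N = derive1 (fun x => smooth_step (N * x + (- (N * a))))).
  by apply: smooth_continuous; apply: smooth_derive1; apply: smooth_affine;
    exact: smooth_smooth_step.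
by apply/funext => x; rewrite derive1E; have [_ ->] := is_derive_smooth_step_affine a N x.
Qed.

Lemma smooth_cutoff a b N : smooth (cutoff a b N).
Proof. by apply: smoothB; apply: smooth_affine; exact: smooth_smooth_step. Qed.

Lemma derive1_cutoff a b N x :
  derive1 (cutoff a b N) x = mollifier_at a N x - mollifier_at b N x.
Proof.
rewrite derive1E.
have [] := is_deriveB (is_derive_smooth_step_affine a N x)
  (is_derive_smooth_step_affine b N x).
by [].
Qed.

Lemma mollifier_at_ge0 a N x : 0 <= N -> 0 <= mollifier_at a N x.
Proof. by move=> N0; rewrite mulr_ge0// mollifier_ge0. Qed.

Lemma mollifier_at_le a N x : 0 <= N -> mollifier_at a N x <= N.
Proof. by move=> N0; rewrite ler_piMr// mollifier_le1. Qed.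

Lemma mollifier_at_out a N x : 0 < N -> N^-1 <= `|x - a| -> mollifier_at a N x = 0.
Proof.
move=> N0 xa; rewrite /mollifier_at mollifier_out ?mulr0// -mulrN -mulrDr normrM.
by rewrite (gtr0_norm N0) -ler_pdivrMl// mulr1.
Qed.

Lemma cutoff_out a b N x : 0 < N -> a < b ->
  x <= a - N^-1 \/ b + N^-1 <= x -> cutoff a b N x = 0.
Proof.
move=> N0 ab; rewrite /cutoff => -[] H.
  rewrite !smooth_step_left ?subrr// -mulrN -mulrDr -ler_pdivlMl// mulrN1; lra.
rewrite !(@smooth_step_right (_ + _)) ?subrr// -mulrN -mulrDr -ler_pdivrMl// mulr1; lra.
Qed.

Lemma cutoff_le a b N x : `|cutoff a b N x| <= smooth_step 1.
Proof.
rewrite /cutoff ler_norml; have := smooth_step_ge0 (N * x + (- (N * a))).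
have := smooth_step_ge0 (N * x + (- (N * b))).
have := smooth_step_le1 (N * x + (- (N * a))).
by have := smooth_step_le1 (N * x + (- (N * b))); lra.
Qed.

Lemma test_function_cutoff um up s t a b N : 0 < N -> a < b ->
  um < s -> t < up -> s <= a - N^-1 -> b + N^-1 <= t ->
  test_function um up (cutoff a b N).
Proof.
move=> N0 ab ums tup sa bt.
have supp : closure [set x | cutoff a b N x != 0] `<=` `[s, t].
  apply: (@subset_trans _ (closure `[s, t])); last first.
    by apply: compact_closed; [exact: Rhausdorff|exact: segment_compact].
  apply: closureS =>  x /=; rewrite in_itv/= => cx; apply/andP; split; rewrite leNgt;
    apply/negP => xs; move/eqP : cx; apply; apply: cutoff_out => //.
    by left; lra.
  by right; lra.
split; first exact: smooth_cutoff.
  apply: subclosed_compact supp; [exact: closed_closure|exact: segment_compact].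
apply: subset_trans supp _ => x /=; rewrite !in_itv/= => /andP[sx xt].
by rewrite (lt_le_trans ums)//= (le_lt_trans xt).
Qed.

End weak_derivative.

(** * Weak derivatives *)

Section lebesgue_points.
Set Implicit Arguments.
Unset Strict Implicit.
Context {R : realType}.
Local Notation mu := (@lebesgue_measure R).
Implicit Types (f g : R -> R) (x y a b s t e r N : R).

Lemma mollifier_at_mass s t a N : 0 < N -> s <= a - N^-1 -> a + N^-1 <= t ->
  \int[mu]_(x in `[s, t]) mollifier_at a N x = smooth_step 1 :> R.
Proof.
move=> N0 sa at_.
have N1 : 0 < N^-1 by rewrite invr_gt0.
have st : s <= t by lra.
have [_ /(_ s t (lexx _) st (lexx _)) <-] :
    abscont s t (fun x => smooth_step (N * x + (- (N * a)))) (mollifier_at a N).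
  apply: is_derive_abscont => [|x _]; last exact: is_derive_smooth_step_affine.
  by apply: continuous_subspaceT; exact: continuous_mollifier_at.
rewrite (@smooth_step_right _ (N * t + _)); last first.
  by rewrite -mulrN -mulrDr -ler_pdivrMl// mulr1; lra.
rewrite (@smooth_step_left _ (N * s + _)) ?subr0//.
by rewrite -mulrN -mulrDr -ler_pdivlMl// mulrN1; lra.
Qed.

Lemma integrable_mollifier_atM s t a N f : mu.-integrable `[s, t] (EFin \o f) ->
  mu.-integrable `[s, t] (EFin \o (fun x => f x * mollifier_at a N x)).
Proof.
move=> fi; have := within_continuous_integrableM
  (continuous_subspaceT (@continuous_mollifier_at R a N)) fi.
by apply: eq_integrable => // x _ /=; rewrite mulrC.
Qed.

(** The constant f a can be subtracted under the integral because the bump has mass [smooth_step 1].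
    The bump is at most N and lives on a ball of measure 2/N, so the remaining integral is at most
    twice the mean oscillation [davg]. *)
Lemma mollifier_at_davg s t a N f : 0 < N -> s <= a - N^-1 -> a + N^-1 <= t ->
  mu.-integrable `[s, t] (EFin \o f) ->
  (`|\int[mu]_(x in `[s, t]) (f x * mollifier_at a N x) - f a * smooth_step 1|%:E
   <= 2%:E * davg (f \_ `[s, t]) a N^-1)%E.
Proof.
move=> N0 sa at_ fi; pose f0 := f \_ `[s, t].
have N1 : 0 < N^-1 by rewrite invr_gt0.
have ast : s <= a <= t by lra.
have f0E x : s <= x <= t -> f0 x = f x.
  by move=> xst; rewrite /f0 patchE mem_set.
have ci (c : R) : mu.-integrable `[s, t] (EFin \o cst c).
  apply: continuous_compact_integrable; first exact: segment_compact.
  by move=> x; exact: cvg_cst.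
have di : mu.-integrable `[s, t] (EFin \o (fun x => f x - f a)).
  by apply: integrable_fctB => //; exact: ci.
have dki := integrable_mollifier_atM a N di.
have -> : \int[mu]_(x in `[s, t]) (f x * mollifier_at a N x) - f a * smooth_step 1 =
    \int[mu]_(x in `[s, t]) ((f x - f a) * mollifier_at a N x).
  rewrite -(mollifier_at_mass N0 sa at_) -RintegralZl//; last first.
    have := integrable_mollifier_atM a N (ci 1).
    by apply: eq_integrable => // x _ /=; rewrite mul1r.
  rewrite -RintegralB//; last 2 first.
  - exact: integrable_mollifier_atM.
  - exact: integrable_mollifier_atM (ci (f a)).
  by apply: eq_Rintegral => x _; rewrite mulrBl.
rewrite EFin_normr_Rintegral//.
apply: (le_trans (le_abse_integral _ _ _)) => //.
  by case/integrableP : dki.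
have f0m : measurable_fun setT f0.
  by apply/(measurable_restrictT _ _).1 => //; case/integrableP : fi => /measurable_EFinP.
have -> : (2%:E * davg f0 a N^-1 =
    \int[mu]_(y in ball a N^-1) (N * `|f0 y - f0 a|)%:E)%E.
  rewrite /davg /iavg lebesgue_measure_ball ?ltW//.
  under [in RHS]eq_integral do rewrite EFinM.
  rewrite ge0_integralZl//; last 2 first.
  - apply/measurable_EFinP; apply: measurableT_comp => //.
    by apply: measurable_funB => //; exact: measurable_funS f0m.
  - by rewrite lee_fin ltW.
  2: exact: measurable_ball.
  rewrite muleA; congr (_ * _)%E.
  rewrite inver gt_eqF ?mulrn_wgt0// -EFinM; congr (_%:E).
  by rewrite -(mulr_natr N^-1) invfM invrK mulrCA divff ?mulr1 ?pnatr_eq0.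
rewrite [X in (X <= _)%E]integral_mkcond [X in (_ <= X)%E]integral_mkcond.
have dm : measurable_fun setT (fun y => N * `|f0 y - f0 a|).
  apply: measurable_funM => //; apply: measurableT_comp => //.
  exact: measurable_funB.
apply: ge0_le_integral => //.
- by move=> x _; rewrite erestrict_ge0.
- apply/(measurable_restrictT _ _).1 => //.
  by apply: measurableT_comp => //; case/integrableP : dki.
- apply/(measurable_restrictT _ _).1; first exact: measurable_ball.
  apply/measurable_EFinP; exact: measurable_funS dm.
move=> x _; rewrite !patchE; case: ifPn => xst; last first.
  by case: ifPn => // _; rewrite lee_fin mulr_ge0// ltW.
rewrite inE/= in_itv/= in xst; rewrite !f0E//=.
case: ifPn => xa.
  rewrite lee_fin normrM mulrC ler_wpM2r//.
  by rewrite ger0_norm ?mollifier_at_ge0 ?mollifier_at_le// ltW.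
rewrite mollifier_at_out ?mulr0 ?normr0//.
rewrite leNgt; apply/negP => xa'; move/negP : xa; apply.
by rewrite inE/= /ball/= distrC.
Qed.

Lemma near_natS_gt0 r : 0 < r -> \forall n \near \oo, (n.+1%:R)^-1 <= r :> R.
Proof.
move=> r0; have /cvgrPdist_le /(_ r r0) := @cvg_harmonic R.
apply: filterS => n; rewrite sub0r normrN ger0_norm ?harmonic_ge0//.
Qed.

Lemma cvg_mollifier_at s t a f : s < a -> a < t ->
  mu.-integrable `[s, t] (EFin \o f) -> lebesgue_pt (f \_ `[s, t]) a ->
  \int[mu]_(x in `[s, t]) (f x * mollifier_at a n.+1%:R x) @[n --> \oo]
  --> f a * smooth_step 1.
Proof.
move=> sa at_ fi /cvge_at_rightP La.
have {}La : davg (f \_ `[s, t]) a (n.+1%:R)^-1 @[n --> \oo] --> 0%E.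
  apply: La; split; first by move=> n; rewrite invr_gt0.
  exact: cvg_harmonic.
apply/subr_cvg0/norm_cvg0P.
suff /fine_cvg : (`|\int[mu]_(x in `[s, t]) (f x * mollifier_at a n.+1%:R x) -
    f a * smooth_step 1|%:E)%E @[n --> \oo] --> 0%:E by [].
apply: (@squeeze_cvge _ _ _ _ (cst 0%E) _
  (fun n => 2%:E * davg (f \_ `[s, t]) a (n.+1%:R)^-1)%E).
- have sa0 : 0 < a - s by rewrite subr_gt0.
  have at0 : 0 < t - a by rewrite subr_gt0.
  near=> n; rewrite lee_fin normr_ge0/=; apply: mollifier_at_davg => //.
  + by rewrite lerBrDr -lerBrDl; near: n; exact: near_natS_gt0.
  + by rewrite -lerBrDl; near: n; exact: near_natS_gt0.
- exact: cvg_cst.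
- by rewrite -[X in _ --> X](mule0 2%:E); exact: cvgeZl La.
Unshelve. all: by end_near. Qed.

End lebesgue_points.

(** * Weakly differentiable functions as primitives *)

Section weak_derivative_representative.
Set Implicit Arguments.
Unset Strict Implicit.
Context {R : realType}.
Local Notation mu := (@lebesgue_measure R).
Implicit Types (f g F : R -> R) (x y a b s t e r N : R).

Lemma Rintegral_dominated_cvg (D : set R) (f_ : (R -> R)^nat) f g :
  measurable D -> (forall n, measurable_fun D (f_ n)) -> measurable_fun D f ->
  {ae mu, forall x, D x -> f_ n x @[n --> \oo] --> f x} ->
  mu.-integrable D (EFin \o g) ->
  (forall n x, D x -> `|f_ n x| <= g x) ->
  \int[mu]_(x in D) f_ n x @[n --> \oo] --> \int[mu]_(x in D) f x.
Proof.
move=> mD mf_ mf f_f gi f_g.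
have [||||fi _ H] := @dominated_convergence _ _ _ mu D mD
  (fun n => EFin \o f_ n) (EFin \o f) (EFin \o g) _ _ _ gi.
- by move=> n /=; apply/measurable_EFinP; exact: mf_.
- by apply/measurable_EFinP; exact: mf.
- apply: (@filterS _ _ (ae_filter_ringOfSetsType mu) _ _ _ f_f) => x {}f_f Dx.
  by apply: cvg_EFin; [exact: nearW|exact: f_f].
- by apply: aeW => x n Dx /=; rewrite lee_fin; exact: f_g.
apply: fine_cvg; rewrite /Rintegral fineK//.
exact: integrable_fin_num fi.
Qed.

Lemma Rintegral_supported (A D : set R) f :
  (forall x, D x -> A x) -> (forall x, A x -> ~ D x -> f x = 0) ->
  \int[mu]_(x in A) f x = \int[mu]_(x in D) f x.
Proof.
move=> DA f0; rewrite [LHS]Rintegral_mkcond [RHS]Rintegral_mkcond.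
apply: eq_Rintegral => x _; rewrite !patchE.
case: ifPn => xA; case: ifPn => // xD.
  by apply: f0 => [|Dx]; [exact: set_mem|move/negP : xD; apply; exact: mem_set].
by exfalso; move/negP : xA; apply; apply/mem_set/DA/set_mem.
Qed.

Lemma locally_integrable_itv um up s t g : um < s -> t < up ->
  locally_integrable `]um, up[ g -> mu.-integrable `[s, t] (EFin \o g).
Proof.
move=> ums tup [mg _ ig].
have stI : `[s, t] `<=` `]um, up[.
  move=> x /=; rewrite !in_itv/= => /andP[sx xt].
  by rewrite (lt_le_trans ums)//= (le_lt_trans xt).
apply/integrableP; split.
  by apply/measurable_EFinP; exact: measurable_funS mg.
exact: ig stI (@segment_compact _ s t).
Qed.

Lemma cutoff_in a b N x : 0 < N -> a + N^-1 <= x -> x <= b - N^-1 ->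
  cutoff a b N x = smooth_step 1.
Proof.
move=> N0 ax xb; rewrite /cutoff (@smooth_step_right _ (N * x + (- (N * a)))).
  rewrite (@smooth_step_left _ (_ + _)) ?subr0// -mulrN -mulrDr -ler_pdivlMl// mulrN1.
  lra.
by rewrite -mulrN -mulrDr -ler_pdivrMl// mulr1; lra.
Qed.

(** The endpoints are excluded because rescaling does not move them: the values there are eventually
    [smooth_step 0] at [a] and [smooth_step 1 - smooth_step 0] at [b]. Two points are negligible
    under the integral. *)
Lemma cvg_cutoff a b x : a < b -> x != a -> x != b ->
  cutoff a b n.+1%:R x @[n --> \oo] --> ((cst (smooth_step 1 : R)) \_ `[a, b]) x.
Proof.
move=> ab; rewrite !neq_lt patchE => /orP xa /orP xb.
case: ifPn => [|/negP] xI.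
  move: xI; rewrite inE/= in_itv/= => /andP[ax bx].
  have {xa}ax : 0 < x - a by case: xa; lra.
  have {xb bx}bx : 0 < b - x by case: xb; lra.
  apply: cvg_near_cst; near=> n; apply: cutoff_in => //.
    by rewrite -lerBrDl; near: n; exact: near_natS_gt0.
  by rewrite lerBrDr -lerBrDl; near: n; exact: near_natS_gt0.
have {}xI : ~ (a <= x <= b) by move=> H; apply: xI; rewrite inE/= in_itv.
case: xa => xa.
  have xa0 : 0 < a - x by rewrite subr_gt0.
  apply: cvg_near_cst; near=> n; apply: cutoff_out => //; left.
  by rewrite lerBrDr -lerBrDl; near: n; exact: near_natS_gt0.
have bx : 0 < x - b.
  case: xb => xb; last by rewrite subr_gt0.
  by exfalso; apply: xI; rewrite (ltW xa) (ltW xb).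
apply: cvg_near_cst; near=> n; apply: cutoff_out => //; right.
by rewrite -lerBrDl; near: n; exact: near_natS_gt0.
Unshelve. all: by end_near. Qed.

Definition weak_derivative um up f g := forall phi, test_function um up phi ->
  - (\int[mu]_(x in `]um, up[) (f x * derive1 phi x)) =
  \int[mu]_(x in `]um, up[) (g x * phi x).

(* Tested against smooth approximations of the indicator of [a, b], the weak
   derivative identity becomes the fundamental theorem of calculus. *)
Lemma weak_derivative_increment um up s t a b f g :
  weak_derivative um up f g -> um < s -> s < a -> a < b -> b < t -> t < up ->
  mu.-integrable `[s, t] (EFin \o f) -> mu.-integrable `[s, t] (EFin \o g) ->
  lebesgue_pt (f \_ `[s, t]) a -> lebesgue_pt (f \_ `[s, t]) b ->
  f b - f a = \int[mu]_(x in `[a, b]) g x.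
Proof.
move=> W ums sa ab bt tup fi gi La Lb; pose phi n := cutoff a b (n.+1%:R : R).
have mg : measurable_fun `[s, t] g by case/integrableP : gi => /measurable_EFinP.
have sI x : `[s, t]%classic x -> `]um, up[%classic x.
  rewrite /= !in_itv/= => /andP[sx xt].
  by rewrite (lt_le_trans ums)//= (le_lt_trans xt).
have lhs : (- (\int[mu]_(x in `[s, t]) (f x * mollifier_at a n.+1%:R x) -
      \int[mu]_(x in `[s, t]) (f x * mollifier_at b n.+1%:R x))) @[n --> \oo]
    --> - (f a * smooth_step 1 - f b * smooth_step 1).
  apply: cvgN; apply: cvgB; apply: cvg_mollifier_at => //.
  - exact: lt_trans bt.
  - exact: lt_trans ab.
have rhs : \int[mu]_(x in `[s, t]) (g x * phi n x) @[n --> \oo] -->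
    \int[mu]_(x in `[s, t]) (g x * ((cst (smooth_step 1 : R)) \_ `[a, b]) x).
  apply: (Rintegral_dominated_cvg (g := fun x => smooth_step 1 * `|g x|)) => //.
  - move=> n; apply: measurable_funM => //.
    apply: measurable_funTS; apply: continuous_measurable_fun.
    exact/smooth_continuous/smooth_cutoff.
  - apply: measurable_funM => //; apply: measurable_funTS.
    by apply/(measurable_restrictT _ _).1.
  - exists [set a; b]; split.
    + exact: measurableU.
    + apply: countable_lebesgue_measure0; exact: finite_set_countable.
    + move=> x /= /not_implyP[_ xab]; apply: contrapT => /not_orP[xa xb].
      apply: xab; apply: cvgM; first exact: cvg_cst.
      by apply: cvg_cutoff => //; exact/eqP.
  - by apply: integrable_fctZ => //; exact: integrable_norm.
  - move=> n x _; rewrite normrM mulrC ler_wpM2r//; exact: cutoff_le.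
(* Once 1/(n+1) is below the gaps a - s and t - b, the cutoff is a test function supported in
   [s, t], so the weak identity may be restricted to the compact interval on which [f] and [g] are
   integrable. *)
have E : \forall n \near \oo,
    - (\int[mu]_(x in `[s, t]) (f x * mollifier_at a n.+1%:R x) -
      \int[mu]_(x in `[s, t]) (f x * mollifier_at b n.+1%:R x)) =
    \int[mu]_(x in `[s, t]) (g x * phi n x).
  have sa0 : 0 < a - s by rewrite subr_gt0.
  have bt0 : 0 < t - b by rewrite subr_gt0.
  near=> n.
  have n1 : s <= a - (n.+1%:R)^-1.
    by rewrite lerBrDr -lerBrDl; near: n; exact: near_natS_gt0.
  have n2 : b + (n.+1%:R)^-1 <= t.
    by rewrite -lerBrDl; near: n; exact: near_natS_gt0.
  have n0 : 0 < (n.+1%:R : R)^-1 by rewrite invr_gt0.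
  have tf : test_function um up (phi n).
    exact: (@test_function_cutoff _ um up s t).
  have := W _ tf; rewrite (@Rintegral_supported _ `[s, t])//; last first.
    move=> x xI xst; rewrite derive1_cutoff !mollifier_at_out ?subrr ?mulr0//.
      rewrite leNgt; apply/negP; rewrite ltr_norml => /andP[]; move: n1 n2 n0;
        set r := (_^-1) => n1 n2 n0 xb1 xb2; apply: xst.
      by rewrite /= in_itv/=; apply/andP; split; lra.
    rewrite leNgt; apply/negP; rewrite ltr_norml => /andP[]; move: n1 n2 n0;
        set r := (_^-1) => n1 n2 n0 xb1 xb2; apply: xst.
    by rewrite /= in_itv/=; apply/andP; split; lra.
  rewrite (@Rintegral_supported _ `[s, t] (fun x => g x * _))//; last first.
    move=> x xI xst; rewrite /phi cutoff_out ?mulr0//.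
    move: n1 n2 n0; set r := (_^-1) => n1 n2 n0.
    have [xa|xa] := leP x (a - r); [by left|right].
    rewrite leNgt; apply/negP => xb; apply: xst.
    by rewrite /= in_itv/=; apply/andP; split; lra.
  move=> <-; congr (- _); rewrite -RintegralB//; last 2 first.
  - exact: integrable_mollifier_atM.
  - exact: integrable_mollifier_atM.
  by apply: eq_Rintegral => x _; rewrite derive1_cutoff mulrBr.
have {}lhs := cvg_trans (near_eq_cvg E) lhs.
have := @cvg_unique _ (@Rhausdorff R) _ _ _ _ (lhs _) rhs.
rewrite (_ : \int[mu]_(x in `[s, t]) (g x * _) =
    smooth_step 1 * \int[mu]_(x in `[a, b]) g x); last first.
  rewrite -RintegralZl//; last exact: integrable_subitv gi (ltW sa) (ltW bt).
  rewrite (@Rintegral_supported _ `[a, b]).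
  - by apply: eq_Rintegral => x xab; rewrite patchE xab mulrC.
  - move=> x /=; rewrite !in_itv/= => /andP[ax xb].
    by rewrite (le_trans (ltW sa))//= (le_trans xb)// ltW.
  - by move=> x _ xab; rewrite patchE memNset ?mulr0.
move=> H; apply: (mulfI (lt0r_neq0 (@smooth_step1_gt0 R))); rewrite -H; ring.
Unshelve. all: by end_near. Qed.

Lemma weak_derivative_abscont um up f g : um < up ->
  locally_integrable `]um, up[ f -> locally_integrable `]um, up[ g ->
  weak_derivative um up f g ->
  exists2 F, forall s t, um < s -> t < up -> abscont s t F g &
    {ae mu, forall x, `]um, up[%classic x -> f x = F x}.
Proof.
move=> umup lf lg W; pose h := (up - um) / 2.
have h0 : 0 < h by rewrite divr_gt0// subr_gt0.
clearbody h.
pose s_ (k : nat) := um + h * k.+1%:R^-1; pose t_ k := up - h * k.+1%:R^-1.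
have ums k : um < s_ k by rewrite /s_ ltrDl mulr_gt0// invr_gt0.
have tup k : t_ k < up by rewrite /t_ gtrBl mulr_gt0// invr_gt0.
have fi k := locally_integrable_itv (ums k) (tup k) lf.
have gi s t : um < s -> t < up -> mu.-integrable `[s, t] (EFin \o g).
  by move=> *; exact: locally_integrable_itv lg.
have inst x : um < x < up -> \forall k \near \oo, s_ k < x /\ x < t_ k.
  move=> /andP[umx xup].
  have x1 : 0 < (x - um) / h / 2 by rewrite !divr_gt0// subr_gt0.
  have x2 : 0 < (up - x) / h / 2 by rewrite !divr_gt0// subr_gt0.
  near=> k; split.
    have : (k.+1%:R)^-1 <= (x - um) / h / 2 by near: k; exact: near_natS_gt0.
    rewrite -mulrA -invfM ler_pdivlMr ?mulr_gt0// => H.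
    have : 0 < h * k.+1%:R^-1 by rewrite mulr_gt0// invr_gt0.
    by move: H; rewrite /s_; set r := (_^-1) => H; lra.
  have : (k.+1%:R)^-1 <= (up - x) / h / 2 by near: k; exact: near_natS_gt0.
  rewrite -mulrA -invfM ler_pdivlMr ?mulr_gt0// => H.
  have : 0 < h * k.+1%:R^-1 by rewrite mulr_gt0// invr_gt0.
  by move: H; rewrite /t_; set r := (_^-1) => H; lra.
(* Lebesgue points are taken for all restrictions of an exhaustion at once. The exceptional set is a
   countable union of null sets, and any two points of the open interval lie inside a common
   [[s_ k, t_ k]]. *)
pose good x := forall k, lebesgue_pt (f \_ `[s_ k, t_ k]) x.
have ae_good : {ae mu, forall x, good x}.
  apply: ae_foralln => k; apply: lebesgue_differentiation.
  exact: integrable_locally_restrict.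
have inc a b : um < a -> a < b -> b < up -> good a -> good b ->
    f b - f a = \int[mu]_(x in `[a, b]) g x.
  move=> uma ab bup ga gb.
  have aI : um < a < up by rewrite uma (lt_trans ab).
  have bI : um < b < up by rewrite bup (lt_trans uma).
  have [k [[sa _] [_ bt]]] : exists k, (s_ k < a /\ a < t_ k) /\
      (s_ k < b /\ b < t_ k).
    by near \oo => k; exists k; split; near: k; exact: inst.
  by apply: (weak_derivative_increment W (ums k) sa ab bt (tup k)) => //;
    exact: gi.
(* The exceptional set is null, so it cannot cover an interval of positive length. *)
have [x0 [x0um x0up gx0]] : exists x0, [/\ um < x0, x0 < up & good x0].
  apply: contrapT => nx0; have [A [mA A0 sA]] := ae_good.
  have IA : `]um, up[%classic `<=` A.
    move=> x; rewrite /= in_itv/= => /andP[umx xup]; apply: sA => /= gx.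
    by apply: nx0; exists x.
  have : (mu `]um, up[ <= mu A)%E by apply: le_measure => //; rewrite inE.
  rewrite A0 lebesgue_measure_itv/= lte_fin umup -EFinB lee_fin.
  lra.
(* The base point is a good one, so that [F] agrees with [f] at every good point. Integrals over
   sets carry no orientation, hence the two cases. *)
pose F x := f x0 + (if x0 <= x then \int[mu]_(z in `[x0, x]) g z
                    else - \int[mu]_(z in `[x, x0]) g z).
exists F.
  move=> s t ums' tup'; split; first exact: gi.
  move=> x y sx xy yt; rewrite /F.
  have umx := lt_le_trans ums' sx; have yup := le_lt_trans yt tup'.
  case: ifPn => [x0y|]; case: ifPn => [x0x|].
  - by rewrite (Rintegral_chasles x0x xy); [ring|exact: gi].
  - rewrite -ltNge => /ltW xx0.
    by rewrite (Rintegral_chasles xx0 x0y); [ring|exact: gi].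
  - by move=> x0y; exfalso; move/negP : x0y; apply; exact: le_trans xy.
  - rewrite -!ltNge => /ltW xx0 /ltW yx0.
    by rewrite (Rintegral_chasles xy yx0); [ring|exact: gi].
apply: (@filterS _ _ (ae_filter_ringOfSetsType mu) _ _ _ ae_good) => x gx.
rewrite /= in_itv/= => /andP[umx xup].
rewrite /F; case: (ltgtP x0 x) => [x0x|xx0|<-].
- by rewrite -inc//; ring.
- by rewrite -inc//; ring.
- by rewrite set_itv1 Rintegral_set1 addr0.
Unshelve. all: by end_near. Qed.

End weak_derivative_representative.

(** * Weighted inequalities *)

Section limit_principle.
Set Implicit Arguments.
Unset Strict Implicit.
Context {R : realType}.
Local Notation mu := (@lebesgue_measure R).
Implicit Types (f g h F Q : R -> R) (x y a b c d s t e r C K : R).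

(** A quantitative form of the non-integrability of 1/|x - c|. If |x - c| |h x| > e held on all of A
    k, where |x - c| <= 2k, then |h| would be at least e/(2k) on a set of measure k, and its
    integral at least e/2 however small k is. The sets [A] stand for one-sided intervals on either
    side of [c]. *)
Lemma integrable_small_point h c (A : R -> set R) :
  mu.-integrable setT (EFin \o h) ->
  (forall r, measurable (A r)) -> (forall r, 0 < r -> mu (A r) = r%:E) ->
  (forall r x, A r x -> r <= `|x - c| <= r * 2) ->
  forall e d, 0 < e -> 0 < d -> exists r x,
    [/\ 0 < r, r < d, A r x & `|x - c| * `|h x| <= e].
Proof.
move=> hi mA muA Ac e d e0 d0; apply: contrapT => H.
have e2 : 0 < e / 2 by rewrite divr_gt0.
have [r [r0 Hr]] := @integral_normr_continuous _ _ _ mu h hi _ e2.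
pose k := Num.min r d / 2.
have rd0 : 0 < Num.min r d by rewrite lt_min r0.
have k0 : 0 < k by rewrite divr_gt0.
have kmin : k < Num.min r d by rewrite /k ltr_pdivrMr// ltr_pMr// ltr1n.
have [kr kd] : k < r /\ k < d by apply/andP; rewrite -lt_min.
have {Hr} : \int[mu]_(x in A k) `|h x| < e / 2.
  apply: Hr; first exact: mA.
  by rewrite [X in (X < _)%E](_ : _ = k%:E) ?lte_fin//; exact: muA.
have hAi : mu.-integrable (A k) (EFin \o (fun x => `|h x|)).
  by apply: integrable_norm; apply: integrableS hi => //; exact: mA.
apply/negP; rewrite -leNgt.
have -> : e / 2 = \int[mu]_(x in A k) (e / (k * 2)).
  rewrite Rintegral_cst; last exact: mA.
  rewrite [X in fine X](_ : _ = k%:E); last exact: muA.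
  by rewrite /=; field; rewrite gt_eqF.
apply: le_Rintegral => //; first exact: mA.
  apply/integrableP; split; first exact/measurable_EFinP.
  rewrite /= integral_cst; last exact: mA.
  by rewrite [X in (_ * X)%E](_ : _ = k%:E) ?ltry//; exact: muA.
move=> x Akx; have /andP[k1 k2] := Ac _ _ Akx.
have xc : e < `|x - c| * `|h x|.
  by rewrite ltNge; apply/negP => xc; apply: H; exists k, x.
rewrite ler_pdivrMr ?mulr_gt0// mulrC; apply: le_trans (ltW xc) _.
exact: ler_wpM2r.
Qed.

Lemma Rintegral_itv_cvg um up (s_ t_ : R^nat) Q :
  mu.-integrable `]um, up[ (EFin \o Q) ->
  (forall n, um < s_ n) -> (forall n, t_ n < up) ->
  s_ n @[n --> \oo] --> um -> t_ n @[n --> \oo] --> up ->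
  \int[mu]_(x in `[s_ n, t_ n]) Q x @[n --> \oo] -->
  \int[mu]_(x in `]um, up[) Q x.
Proof.
move=> Qi ums tup cs ct.
have mQ : measurable_fun `]um, up[ Q by case/integrableP : Qi => /measurable_EFinP.
rewrite (_ : (fun n => \int[mu]_(x in `[s_ n, t_ n]) Q x) =
    (fun n => \int[mu]_(x in `]um, up[) ((Q \_ `[s_ n, t_ n]) x))); last first.
  apply/funext => n; rewrite -Rintegral_mkcondr; congr (Rintegral _ _ _).
  apply/seteqP; split => x /=; rewrite !in_itv/=; last by case.
  move=> /andP[sx xt]; rewrite sx xt; split=> //.
  by rewrite (lt_le_trans (ums n))//= (le_lt_trans xt).
apply: (Rintegral_dominated_cvg (g := fun x => `|Q x|)) => //.
- move=> n; apply/(measurable_restrict _ _ _) => //.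
  exact: measurable_funS mQ.
- apply: aeW => x; rewrite /= in_itv/= => /andP[umx xup].
  apply: cvg_near_cst; near=> n; rewrite patchE mem_set//= in_itv/=.
  apply/andP; split; apply: ltW; near: n.
    exact: (cvgr_lt um).
  exact: (cvgr_gt up).
- exact: integrable_norm.
- by move=> n x _; rewrite patchE; case: ifPn => // _; rewrite normr0.
Unshelve. all: by end_near. Qed.

(** As [w] vanishes linearly at the endpoints, the error w (1 + phi^2) is at most C |x - c| (1 +
    phi^2), which is small at suitable points near each endpoint [c]. The summand [w] without phi^2
    accommodates boundary terms that are linear in [phi]. The two endpoints are approached along
    independently chosen sequences, so the hypothesis is asked for all pairs s, t. *)
Lemma limit_principle um up (w phi : R -> R) C K r Q : um < up -> 0 <= K -> 0 < r ->
  0 <= C ->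
  (forall x, um < x < up -> 0 <= w x) ->
  (forall x, um < x < up -> w x <= C * `|x - um|) ->
  (forall x, um < x < up -> w x <= C * `|x - up|) ->
  mu.-integrable `]um, up[ (EFin \o (fun x => phi x ^+ 2)) ->
  mu.-integrable `]um, up[ (EFin \o Q) ->
  (forall s t, um < s -> s < um + r -> up - r < t -> t < up ->
    0 <= \int[mu]_(x in `[s, t]) Q x +
      K * ((w s + w s * phi s ^+ 2) + (w t + w t * phi t ^+ 2))) ->
  0 <= \int[mu]_(x in `]um, up[) Q x.
Proof.
move=> umup K0 r0 C0 w0 wum wup phii Qi H.
pose h := (fun x => 1 + phi x ^+ 2) \_ `]um, up[.
have hE x : um < x < up -> h x = 1 + phi x ^+ 2.
  by move=> xI; rewrite /h patchE mem_set//= in_itv.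
have hi : mu.-integrable setT (EFin \o h).
  rewrite -restrict_EFin; apply/integrable_restrict => //=; rewrite setTI.
  by apply: integrable_fctD => //; exact: integrable_cst_oo.
have E_le x c : um < x < up -> w x <= C * `|x - c| ->
    w x + w x * phi x ^+ 2 <= C * (`|x - c| * `|h x|).
  move=> xI wxc; have p0 : 0 <= 1 + phi x ^+ 2 by rewrite addr_ge0// sqr_ge0.
  have -> : w x + w x * phi x ^+ 2 = w x * (1 + phi x ^+ 2) by ring.
  by rewrite hE// (ger0_norm p0) mulrA ler_wpM2r.
(* Halved because the points found at scale k lie at distance up to 2k from the endpoint. *)
pose d : R := Num.min r (up - um) / 2.
have rd0 : 0 < Num.min r (up - um) by rewrite lt_min r0 subr_gt0.
have d0 : 0 < d by rewrite divr_gt0.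
have dr : d * 2 <= r by rewrite /d divfK// ge_min lexx.
have dup : d * 2 <= up - um by rewrite /d divfK// ge_min lexx orbT.
clearbody d.
have N0 n : 0 < (n.+1%:R : R)^-1 by rewrite invr_gt0.
have N1 n : (n.+1%:R : R)^-1 <= 1 by rewrite invf_le1// ler1n.
have dN n : 0 < d * n.+1%:R^-1 by rewrite mulr_gt0.
have dN1 n : d * n.+1%:R^-1 <= d by rewrite ler_piMr// ltW.
have left_pt n : {s | [/\ um < s, s - um < d * n.+1%:R^-1 * 2 &
    w s + w s * phi s ^+ 2 <= C * n.+1%:R^-1]}.
  apply: cid.
  have [k|k k0|k x|k [x [k0 kd]]] := @integrable_small_point h um
    (fun k => `[um + k, um + k * 2]%classic) hi _ _ _ _ _ (N0 n) (dN n).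
  - exact: measurable_itv.
  - by rewrite lebesgue_measure_cc; [congr (_%:E); ring|lra].
  - rewrite /= in_itv/= => /andP[x1 x2]; rewrite ger0_norm; [|lra].
    by apply/andP; split; lra.
  rewrite /= in_itv/= => /andP[x1 x2] xE; exists x.
  move: kd (dN1 n) xE; set q := (_^-1) => kd dq xE; split; [lra|lra|].
  have xI : um < x < up by apply/andP; split; lra.
  apply: le_trans (E_le x um xI (wum x xI)) _.
  exact: ler_wpM2l.
have right_pt n : {t | [/\ t < up, up - t < d * n.+1%:R^-1 * 2 &
    w t + w t * phi t ^+ 2 <= C * n.+1%:R^-1]}.
  apply: cid.
  have [k|k k0|k x|k [x [k0 kd]]] := @integrable_small_point h up
    (fun k => `[up - k * 2, up - k]%classic) hi _ _ _ _ _ (N0 n) (dN n).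
  - exact: measurable_itv.
  - by rewrite lebesgue_measure_cc; [congr (_%:E); ring|lra].
  - rewrite /= in_itv/= => /andP[x1 x2]; rewrite ler0_norm; [|lra].
    by apply/andP; split; lra.
  rewrite /= in_itv/= => /andP[x1 x2] xE; exists x.
  move: kd (dN1 n) xE; set q := (_^-1) => kd dq xE; split; [lra|lra|].
  have xI : um < x < up by apply/andP; split; lra.
  apply: le_trans (E_le x up xI (wup x xI)) _.
  exact: ler_wpM2l.
pose s_ n := sval (left_pt n); pose t_ n := sval (right_pt n).
have sP n : [/\ um < s_ n, s_ n - um < d * n.+1%:R^-1 * 2 &
    w (s_ n) + w (s_ n) * phi (s_ n) ^+ 2 <= C * n.+1%:R^-1].
  exact: svalP (left_pt n).
have tP n : [/\ t_ n < up, up - t_ n < d * n.+1%:R^-1 * 2 &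
    w (t_ n) + w (t_ n) * phi (t_ n) ^+ 2 <= C * n.+1%:R^-1].
  exact: svalP (right_pt n).
have cN (c : R) : c * n.+1%:R^-1 @[n --> \oo] --> 0.
  by rewrite -[X in _ --> X](mulr0 c); apply: cvgM; [exact: cvg_cst|exact: cvg_harmonic].
have cs : s_ n @[n --> \oo] --> um.
  apply: (@squeeze_cvgr _ _ _ _ (cst um) (fun n => um + (d * 2) * n.+1%:R^-1)).
  - near=> n; have [s1 s2 _] := sP n.
    by apply/andP; split; rewrite /=; [exact: ltW|move: s2; set q := _^-1 => s2; lra].
  - exact: cvg_cst.
  - rewrite -[X in _ --> X](addr0 um); apply: cvgD; [exact: cvg_cst|exact: cN].
have ct : t_ n @[n --> \oo] --> up.
  apply: (@squeeze_cvgr _ _ _ _ (fun n => up - (d * 2) * n.+1%:R^-1) (cst up)).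
  - near=> n; have [s1 s2 _] := tP n.
    by apply/andP; split; rewrite /=; [move: s2; set q := _^-1 => s2; lra|exact: ltW].
  - rewrite -[X in _ --> X](subr0 up); apply: cvgB; [exact: cvg_cst|exact: cN].
  - exact: cvg_cst.
have cQ : \int[mu]_(x in `[s_ n, t_ n]) Q x + (K * C * 2) * n.+1%:R^-1 @[n --> \oo]
    --> \int[mu]_(x in `]um, up[) Q x + 0.
  apply: cvgD; last exact: cN.
  apply: Rintegral_itv_cvg => //; first by move=> n; have [] := sP n.
  by move=> n; have [] := tP n.
rewrite -[leRHS]addr0; apply: ler_cvg_to (cvg_cst 0) cQ _.
near=> n; have [s1 s2 s3] := sP n; have [t1 t2 t3] := tP n.
have n1 := dN1 n.
have st : um < s_ n /\ s_ n < um + r /\ up - r < t_ n /\ t_ n < up.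
  by move: s2 t2 n1; set q := _^-1 => s2 t2 n1; do !split; lra.
have [h1 [h2 [h3 h4]]] := st; apply: le_trans (H _ _ h1 h2 h3 h4) _.
rewrite lerD2l (_ : K * C * 2 * _ = K * (C * n.+1%:R^-1 + C * n.+1%:R^-1)).
  by apply: ler_wpM2l => //; exact: lerD.
ring.
Unshelve. all: by end_near. Qed.

End limit_principle.

(** * Four integral inequalities from completed squares *)

Section weighted_inequalities.
Set Implicit Arguments.
Unset Strict Implicit.
Context {R : realType} (m l : R) (l_gt0 : 0 < l).
Local Notation mu := (@lebesgue_measure R).
Implicit Types (F f h B e Q c : R -> R) (x y s t : R).

(** The common scheme of what follows: the integrand [Q] exceeds an exact derivative [e] by squares
    with nonnegative weights, and only the boundary values of [B] are left to estimate. *)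
Lemma ge_abscont s t B e Q : s <= t -> abscont s t B e ->
  mu.-integrable `[s, t] (EFin \o Q) ->
  (forall x, s <= x <= t -> e x <= Q x) ->
  B t - B s <= \int[mu]_(x in `[s, t]) Q x.
Proof.
move=> st [ei Be] Qi eQ; rewrite Be//; exact: le_Rintegral.
Qed.

Definition weight x := l ^+ 2 - (x - m) ^+ 2.

Lemma abscont_sub_m s t : abscont s t (fun x => x - m) (fun=> 1).
Proof.
apply: is_derive_abscont => [|x _].
  by apply: continuous_subspaceT => x; exact: cvg_cst.
have dxm := is_deriveB (is_derive_id x (1 : R)) (is_derive_cst m x 1).
by apply: is_derive_eq dxm _; rewrite subr0.
Qed.

Lemma abscont_weight s t : abscont s t weight (fun x => -2 * (x - m)).
Proof.
have pp := abscontM (abscont_sub_m s t) (abscont_sub_m s t).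
have := abscontD (abscont_cst s t (l ^+ 2)) (abscontM (abscont_cst s t (-1)) pp).
by apply: eq_abscont => x _; rewrite /weight; ring.
Qed.

Lemma weight_ge0 x : m - l <= x <= m + l -> 0 <= weight x.
Proof.
move=> /andP[x1 x2]; have -> : weight x = (x - (m - l)) * (m + l - x).
  by rewrite /weight; ring.
by rewrite mulr_ge0// subr_ge0.
Qed.

Lemma weight_le x : weight x <= l ^+ 2.
Proof. by rewrite /weight gerBl sqr_ge0. Qed.

Lemma integrable_abscontM c c' h : abscont (m - l) (m + l) c c' ->
  mu.-integrable `]m - l, m + l[ (EFin \o h) ->
  mu.-integrable `]m - l, m + l[ (EFin \o (fun x => c x * h x)).
Proof.
move=> cc' hi; have ml : m - l <= m + l by have := l_gt0; lra.
have cc := abscont_continuous ml cc'.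
have sI : `]m - l, m + l[ `<=` `[m - l, m + l] by exact: subset_itv_oo_cc.
rewrite (_ : EFin \o _ = (EFin \o c) \* (EFin \o h))%E; last first.
  by apply/funext => x /=; rewrite EFinM.
apply: integrableMr => //.
  apply: measurable_funS sI _ => //.
  exact: subspace_continuous_measurable_fun.
have /compact_bounded[M [Mr mrt]] :=
  continuous_compact cc (@segment_compact _ (m - l) (m + l)).
exists M; split=> // x Mx y /= yI; apply: mrt => //; exists y => //.
exact: sI.
Qed.

Lemma abscont_inv_affine (a b s t : R) :
  (forall x, s <= x <= t -> a * x + b != 0) ->
  abscont s t (fun x => (a * x + b)^-1)
    (fun x => - a * ((a * x + b)^-1 * (a * x + b)^-1)).
Proof.
move=> ab0.
have dV x : s <= x <= t -> is_derive x 1 (fun x => (a * x + b)^-1)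
    (- a * ((a * x + b)^-1 * (a * x + b)^-1)).
  move=> xst; have dab := is_derive_affine a b x.
  apply: DeriveDef; first by apply: derivableV; [exact: ab0|have [] := dab].
  rewrite deriveV; [|exact: ab0|by have [] := dab].
  have [_ ->] := dab; rewrite /GRing.scale /= expr2 invfM; ring.
apply: is_derive_abscont => //.
apply: continuous_in_subspaceT => x; rewrite inE/= in_itv/= => xst.
apply/differentiable_continuous/derivable1_diffP.
by have [] := is_deriveZ (- a) (is_deriveM (dV x xst) (dV x xst)).
Qed.

Context (phi psi g : R -> R).
Context (dphi : forall s t, m - l < s -> t < m + l -> abscont s t phi psi).
Context (dpsi : forall s t, m - l < s -> t < m + l -> abscont s t psi g).
Context (phi_int : mu.-integrable `]m - l, m + l[ (EFin \o phi)).
Context (phi2_int : mu.-integrable `]m - l, m + l[ (EFin \o (fun x => phi x ^+ 2))).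
Context (psi2_int : mu.-integrable `]m - l, m + l[
  (EFin \o (fun x => weight x * psi x ^+ 2))).
Context (g2_int : mu.-integrable `]m - l, m + l[
  (EFin \o (fun x => weight x ^+ 3 * g x ^+ 2))).

Lemma integrable_itv_sub s t h : m - l < s -> t < m + l ->
  mu.-integrable `]m - l, m + l[ (EFin \o h) -> mu.-integrable `[s, t] (EFin \o h).
Proof.
move=> ls tl; apply: integrableS => // x /=; rewrite !in_itv/= => /andP[sx xt].
by rewrite (lt_le_trans ls)//= (le_lt_trans xt).
Qed.

Lemma weight_limit_principle (K : R) Q : 0 <= K ->
  mu.-integrable `]m - l, m + l[ (EFin \o Q) ->
  (forall s t, m - l < s -> s < m - l / 2 -> m + l / 2 < t -> t < m + l ->
    - (K * ((weight s + weight s * phi s ^+ 2) +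
         (weight t + weight t * phi t ^+ 2))) <= \int[mu]_(x in `[s, t]) Q x) ->
  0 <= \int[mu]_(x in `]m - l, m + l[) Q x.
Proof.
move=> K0 Qi H; have l0 := l_gt0.
apply: (@limit_principle _ _ _ weight phi (2 * l) K (l / 2)) => //.
- lra.
- lra.
- lra.
- by move=> x /andP[x1 x2]; rewrite weight_ge0// (ltW x1) (ltW x2).
- move=> x /andP[x1 x2]; rewrite ger0_norm; last lra.
  have -> : weight x = (m + l - x) * (x - (m - l)) by rewrite /weight; ring.
  by apply: ler_wpM2r; lra.
- move=> x /andP[x1 x2]; rewrite ler0_norm; last lra.
  have -> : weight x = (x - (m - l)) * - (x - (m + l)) by rewrite /weight; ring.
  by apply: ler_wpM2r; lra.
- move=> s t ls sl lt_ tl; rewrite -lerBlDr sub0r; apply: H => //; lra.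
Qed.

(** Here a, b, c stand for phi, psi and the distance to the midpoint. The limit principle makes w
    phi^2 small but says nothing about [psi], so the terms in b must be absorbed by sign: for c >=
    l/2 the term 2 c w^2 b^2 dominates l w^2 b^2, which completes the square with - 6 w^2 a b. The
    remainder is a multiple of w a^2, and 15 l covers it. *)
Lemma boundary_bound (a b c : R) : l / 2 <= c -> c <= l ->
  0 <= (l ^+ 2 - c ^+ 2) ^+ 2 * (2 * c * b ^+ 2 - 6 * a * b)
      - 6 * c * (l ^+ 2 - c ^+ 2) * a ^+ 2 + 15 * l * ((l ^+ 2 - c ^+ 2) * a ^+ 2).
Proof.
move=> lc cl; have l0 := l_gt0; rewrite -(pmulr_rge0 _ l0).
set w := l ^+ 2 - c ^+ 2.
have w0 : 0 <= w by rewrite /w subr_ge0 ler_sqr ?nnegrE; lra.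
have -> : l * (w ^+ 2 * (2 * c * b ^+ 2 - 6 * a * b) - 6 * c * w * a ^+ 2 +
    15 * l * (w * a ^+ 2)) =
  w ^+ 2 * (l * b - 3 * a) ^+ 2 + w ^+ 2 * ((2 * c - l) * l) * b ^+ 2 +
  w * a ^+ 2 * (6 * l * (l - c) + 9 * c ^+ 2).
  by rewrite /w; ring.
have lc0 : 0 <= 6 * l * (l - c) by rewrite mulr_ge0//; lra.
have cl0 : 0 <= (2 * c - l) * l by rewrite mulr_ge0//; lra.
have c0 : 0 <= 9 * c ^+ 2 by rewrite mulr_ge0// sqr_ge0.
have H0 : 0 <= 6 * l * (l - c) + 9 * c ^+ 2 by exact: addr_ge0.
apply: addr_ge0; [apply: addr_ge0|].
- by apply: mulr_ge0; exact: sqr_ge0.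
- by rewrite mulr_ge0 ?sqr_ge0// mulr_ge0// sqr_ge0.
- by rewrite mulr_ge0// mulr_ge0// sqr_ge0.
Qed.

(* [w^3 g^2 - 4 l^2 w psi^2 + 9 w phi^2 + 6 (3 (x - m)^2 - l^2) phi^2] is the
   square [w ((w psi)' + 3 phi)^2] up to a derivative. *)
Lemma second_order_inequality :
  0 <= \int[mu]_(x in `]m - l, m + l[)
    (weight x ^+ 3 * g x ^+ 2 + (- (4 * l ^+ 2) * (weight x * psi x ^+ 2)
     + (12 * l ^+ 2 * phi x ^+ 2 + - 9 * (weight x * phi x ^+ 2)))).
Proof.
have l0 := l_gt0; apply: (@weight_limit_principle (15 * l)); first lra.
  apply: integrable_fctD => //; apply: integrable_fctD => //.
    exact: integrable_fctZ.
  apply: integrable_fctD => //; first exact: integrable_fctZ.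
  apply: integrable_fctZ => //.
  exact: integrable_abscontM (abscont_weight _ _) phi2_int.
move=> s t ls sl lt_ tl; set Q := (X in Rintegral _ _ X).
pose B x := weight x ^+ 2 * (2 * (x - m) * psi x ^+ 2 - 6 * phi x * psi x)
  - 6 * (x - m) * weight x * phi x ^+ 2.
pose e x := (weight x ^+ 3 * g x ^+ 2 - 4 * l ^+ 2 * (weight x * psi x ^+ 2)
  + 12 * l ^+ 2 * phi x ^+ 2 - 9 * (weight x * phi x ^+ 2)) -
  weight x * (weight x * g x - 2 * (x - m) * psi x + 3 * phi x) ^+ 2.
have st : s <= t by lra.
have Be : abscont s t B e.
  have P := abscont_sub_m s t; have W := abscont_weight s t.
  have Phi := dphi ls tl; have Psi := dpsi ls tl.
  have C k := abscont_cst s t (k : R).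
  have W2 := abscontM W W.
  have T1 := abscontM (C 2) (abscontM P (abscontM Psi Psi)).
  have T2 := abscontM (C (-6)) (abscontM Phi Psi).
  have T3 := abscontM (C (-6)) (abscontM P (abscontM W (abscontM Phi Phi))).
  have := abscontD (abscontM W2 (abscontD T1 T2)) T3.
  by apply: eq_abscont => x _; rewrite /B /e /weight; ring.
have Qi : mu.-integrable `[s, t] (EFin \o Q).
  apply: integrable_itv_sub => //.
  apply: integrable_fctD => //; apply: integrable_fctD => //.
    exact: integrable_fctZ.
  apply: integrable_fctD => //; first exact: integrable_fctZ.
  apply: integrable_fctZ => //.
  exact: integrable_abscontM (abscont_weight _ _) phi2_int.
have xw x : s <= x <= t -> 0 <= weight x by move=> /andP[? ?]; apply: weight_ge0; lra.
have := ge_abscont st Be Qi; have {}Qe : forall x, s <= x <= t -> e x <= Q x.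
  move=> x xst; rewrite /e /Q lerBlDr -subr_ge0.
  have := mulr_ge0 (xw x xst)
    (sqr_ge0 (weight x * g x - 2 * (x - m) * psi x + 3 * phi x)).
  by congr (_ <= _); ring.
move=> /(_ Qe); apply: le_trans.
have Bt : 0 <= B t + 15 * l * (weight t * phi t ^+ 2).
  have := @boundary_bound (phi t) (psi t) (t - m); rewrite -/(weight t).
  by apply; lra.
(* The left end is the right end reflected about [m]: c = m - s, and [psi] changes sign. *)
have Bs : 0 <= - B s + 15 * l * (weight s * phi s ^+ 2).
  have c1 : l / 2 <= m - s by lra.
  have c2 : m - s <= l by lra.
  have := boundary_bound (phi s) (- psi s) c1 c2.
  have -> : l ^+ 2 - (m - s) ^+ 2 = weight s by rewrite /weight; ring.
  by congr (_ <= _); rewrite /B; ring.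
have ws : 0 <= 15 * l * weight s by rewrite mulr_ge0//; [lra|apply: xw; lra].
have wt : 0 <= 15 * l * weight t by rewrite mulr_ge0//; [lra|apply: xw; lra].
move: (weight s) (weight t) (phi s ^+ 2) (phi t ^+ 2) Bs Bt ws wt => a b c d.
move: (B s) (B t) => Bs Bt; lra.
Qed.

(** With f = phi - phi m, the inequality int w^2 psi^2 >= 4 int w f^2 has extremal x - m, whose
    logarithmic derivative 1/(x - m) is the exact multiplier but is singular at [m]. The multiplier
    6 / (7 (x - m) + sigma l) stays close to it, and its denominator does not vanish on the side of
    [m] selected by the sign sigma. *)
Definition riccati_boundary sigma x :=
  weight x ^+ 2 * (6 / (7 * (x - m) + sigma * l)) * (phi x - phi m) ^+ 2.

(* The Riccati multiplier 6 / (7 (x - m) +- l) is bounded and gives the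
   constant 11/4, close enough to the optimal 4. *)
Lemma half_poincare (sigma s t : R) : sigma ^+ 2 = 1 -> m - l < s -> s <= t ->
  t < m + l -> (forall x, s <= x <= t -> 0 <= sigma * (x - m)) ->
  riccati_boundary sigma t - riccati_boundary sigma s <= \int[mu]_(x in `[s, t])
    (l ^+ 2 * (weight x * psi x ^+ 2)
     + - (11 / 4) * (weight x * (phi x - phi m) ^+ 2)).
Proof.
move=> sig ls st tl sp; have l0 := l_gt0; set B := riccati_boundary sigma.
pose u x := 7 * x + (sigma * l - 7 * m).
have uE x : 7 * (x - m) + sigma * l = u x by rewrite /u; ring.
have uE2 x : s <= x <= t -> sigma * u x = 7 * (sigma * (x - m)) + l.
  move=> _; have -> : sigma * u x = 7 * (sigma * (x - m)) + sigma ^+ 2 * l.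
    by rewrite /u; ring.
  by rewrite sig mul1r.
have u_neq0 x : s <= x <= t -> u x != 0.
  move=> xst; have sx := sp x xst; apply/eqP => ux0.
  by have := uE2 x xst; rewrite ux0 mulr0; lra.
pose w := weight; pose f x := phi x - phi m.
pose v x := (u x)^-1.
pose e x := w x ^+ 2 * (6 * v x) * (2 * f x * psi x) +
  (w x ^+ 2 * (6 * (- 7 * (v x * v x))) - 4 * (x - m) * w x * (6 * v x)) * f x ^+ 2.
have Be : abscont s t B e.
  have W := abscont_weight s t.
  have C k := abscont_cst s t (k : R).
  have F := abscontD (dphi ls tl) (C (- phi m)).
  have V := abscont_inv_affine u_neq0.
  have := abscontM (abscontM (abscontM W W) (abscontM (C 6) V)) (abscontM F F).
  by apply: eq_abscont => x _; rewrite /B /riccati_boundary ?uE /e /w /f /v -/(u x); ring.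
have fI : mu.-integrable `[s, t] (EFin \o (fun x => f x ^+ 2)).
  have F := abscontD (dphi ls tl) (abscont_cst s t (- phi m)).
  apply: continuous_compact_integrable; first exact: segment_compact.
  have := abscont_continuous st (abscontM F F).
  by apply: subspace_eq_continuous => x _; rewrite /from_subspace /f; ring.
have Qi : mu.-integrable `[s, t] (EFin \o (fun x =>
    l ^+ 2 * (weight x * psi x ^+ 2) + - (11 / 4) * (weight x * f x ^+ 2))).
  apply: integrable_fctD => //; apply: integrable_fctZ => //.
    exact: integrable_itv_sub psi2_int.
  exact: within_continuous_integrableM (abscont_continuous st (abscont_weight s t)) fI.
apply: (ge_abscont st Be Qi) => x xst; have sx := sp x xst; have un0 := u_neq0 x xst.
have w0 : 0 <= w x by apply: weight_ge0; move/andP : xst => [? ?]; lra.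
have wl : w x <= l ^+ 2 := weight_le x.
rewrite -subr_ge0.
(* The Riccati inequality for the multiplier 6 v. Multiplied by 4 (u x)^2 it becomes 109 P^2 - 58 P
   l + 13 l^2 >= 0 with P = sigma (x - m), a form of negative discriminant, displayed below as a sum
   of squares. *)
have K0 : 0 <= 24 * (x - m) * v x + 6 * w x * v x ^+ 2 - 11 / 4.
  have -> : 24 * (x - m) * v x + 6 * w x * v x ^+ 2 - 11 / 4 =
    v x ^+ 2 * ((10 * (sigma * (x - m)) - 29 / 10 * l) ^+ 2 +
     9 * (sigma * (x - m)) ^+ 2 + 459 / 100 * l ^+ 2) / 4.
    have -> : (10 * (sigma * (x - m)) - 29 / 10 * l) ^+ 2 +
      9 * (sigma * (x - m)) ^+ 2 + 459 / 100 * l ^+ 2 =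
      109 * (sigma ^+ 2) * (x - m) ^+ 2 - 58 * sigma * (x - m) * l + 13 * l ^+ 2.
      by field.
    have ll : l ^+ 2 = sigma ^+ 2 * l ^+ 2 by rewrite sig mul1r.
    rewrite sig mulr1 /v /w /weight.
    suff : 96 * (x - m) * u x + 24 * (l ^+ 2 - (x - m) ^+ 2) - 11 * u x ^+ 2 =
      109 * (x - m) ^+ 2 - 58 * sigma * (x - m) * l + 13 * l ^+ 2.
      by move=> <-; field.
    have -> : u x ^+ 2 =
        49 * (x - m) ^+ 2 + 14 * (x - m) * sigma * l + sigma ^+ 2 * l ^+ 2.
      by rewrite /u; ring.
    by rewrite -ll /u; ring.
  apply: divr_ge0; last exact: ler0n.
  apply: mulr_ge0; first exact: sqr_ge0.
  apply: addr_ge0; [apply: addr_ge0; first exact: sqr_ge0|].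
    by rewrite mulr_ge0// sqr_ge0.
  by apply: mulr_ge0; [lra|exact: sqr_ge0].
(* The first summand is the loss incurred in replacing l^2 w psi^2 by w^2 psi^2, the second is the
   completed square, the third is the Riccati remainder. *)
have -> : l ^+ 2 * (weight x * psi x ^+ 2) +
    - (11 / 4) * (weight x * (phi x - phi m) ^+ 2) - e x =
  (l ^+ 2 - w x) * w x * psi x ^+ 2 + w x ^+ 2 * (psi x - 6 * v x * f x) ^+ 2 +
  w x * f x ^+ 2 * (24 * (x - m) * v x + 6 * w x * v x ^+ 2 - 11 / 4).
  by rewrite /e /f -/(w x); field.
apply: addr_ge0; [apply: addr_ge0|].
- by rewrite mulr_ge0 ?sqr_ge0// mulr_ge0// subr_ge0.
- by apply: mulr_ge0; exact: sqr_ge0.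
- by rewrite mulr_ge0// mulr_ge0// sqr_ge0.
Qed.

Lemma weighted_poincare :
  0 <= \int[mu]_(x in `]m - l, m + l[)
    (l ^+ 2 * (weight x * psi x ^+ 2)
     + - (11 / 4) * (weight x * (phi x - phi m) ^+ 2)).
Proof.
have l0 := l_gt0; set Q := (X in Rintegral _ _ X).
have Qi : mu.-integrable `]m - l, m + l[ (EFin \o Q).
  apply: integrable_fctD => //; first exact: integrable_fctZ.
  apply: integrable_fctZ => //.
  apply: (integrable_abscontM (abscont_weight _ _)).
  have : mu.-integrable `]m - l, m + l[
      (EFin \o (fun x => phi x ^+ 2 + (- 2 * phi m * phi x + phi m ^+ 2 * 1))).
    apply: integrable_fctD => //; apply: integrable_fctD => //.
      exact: integrable_fctZ.
    by apply: integrable_fctZ => //; exact: integrable_cst_oo.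
  by apply: eq_integrable => // x _ /=; congr (_%:E); ring.
(* No boundary error arises: subtracting [phi m] kills the boundary terms at [m], and at [s] and [t]
   the multiplier has the sign that allows them to be dropped. *)
apply: (@weight_limit_principle 0) => // s t ls sl lt_ tl.
rewrite mul0r oppr0.
have sm : s <= m by lra.
have mt : m <= t by lra.
have mtl : m < m + l by lra.
have mlm : m - l < m by lra.
have rm0 sigma : riccati_boundary sigma m = 0.
  by rewrite /riccati_boundary (subrr (phi m)) expr0n/= mulr0.
have Qst := integrable_itv_sub ls tl Qi.
rewrite (Rintegral_chasles sm mt Qst); apply: addr_ge0.
  have := @half_poincare (-1) s m _ ls sm mtl.
  rewrite sqrrN expr1n => /(_ erefl).
  have p0 x : s <= x <= m -> 0 <= -1 * (x - m) by move=> /andP[? ?]; lra.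
  move=> /(_ p0) /=; apply: le_trans.
  rewrite rm0 sub0r oppr_ge0 /riccati_boundary.
  rewrite -mulrA mulr_ge0_le0 ?sqr_ge0// mulr_le0_ge0 ?sqr_ge0//.
  by rewrite mulr_ge0_le0// invr_le0; lra.
have := @half_poincare 1 m t _ mlm mt tl.
rewrite expr1n => /(_ erefl).
have p0 x : m <= x <= t -> 0 <= 1 * (x - m) by move=> /andP[? ?]; lra.
move=> /(_ p0) /=; apply: le_trans.
rewrite rm0 subr0 /riccati_boundary.
rewrite -mulrA mulr_ge0 ?sqr_ge0// mulr_ge0 ?sqr_ge0//.
by rewrite mulr_ge0// invr_ge0; lra.
Qed.

(** Cauchy-Schwarz for int (x - m) w psi in discriminant form: the integral of w (psi + a (x - m))^2
    with [a] left free. The cross term is rewritten through ((x - m) w phi)' = (3 w - 2 l^2) phi +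
    (x - m) w psi, which is how the plain and the weighted mean of [phi] meet. *)
Lemma first_moment_inequality (a : R) :
  0 <= \int[mu]_(x in `]m - l, m + l[)
    (weight x * psi x ^+ 2 + (4 * a * l ^+ 2 * phi x + - (6 * a) * (weight x * phi x)
      + a ^+ 2 * ((x - m) ^+ 2 * weight x))).
Proof.
have l0 := l_gt0; set Q := (X in Rintegral _ _ X).
have Qi : mu.-integrable `]m - l, m + l[ (EFin \o Q).
  apply: integrable_fctD => //; apply: integrable_fctD => //.
    apply: integrable_fctD => //; first exact: integrable_fctZ.
    apply: integrable_fctZ => //.
    exact: integrable_abscontM (abscont_weight _ _) phi_int.
  apply: integrable_fctZ => //.
  have ml : m - l <= m + l by lra.
  apply: (@integrableS _ _ _ mu `[m - l, m + l]) => //.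
    exact: subset_itv_oo_cc.
  apply: continuous_compact_integrable; first exact: segment_compact.
  have P := abscont_sub_m (m - l) (m + l).
  exact: abscont_continuous ml (abscontM (abscontM P P) (abscont_weight _ _)).
apply: (@weight_limit_principle (`|a| * l)) => // [|s t ls sl lt_ tl].
  by rewrite mulr_ge0// ltW.
have st : s <= t by lra.
pose B x := - (2 * a) * (x - m) * weight x * phi x.
pose e x := - (2 * a) * ((l ^+ 2 - 3 * (x - m) ^+ 2) * phi x +
   (x - m) * weight x * psi x).
have Be : abscont s t B e.
  have P := abscont_sub_m s t; have W := abscont_weight s t.
  have := abscontM (abscontM (abscontM (abscont_cst s t (- (2 * a))) P) W) (dphi ls tl).
  by apply: eq_abscont => x _; rewrite /B /e /weight; ring.
have Qst := integrable_itv_sub ls tl Qi.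
have xw x : s <= x <= t -> 0 <= weight x by move=> /andP[? ?]; apply: weight_ge0; lra.
have Qe x : s <= x <= t -> e x <= Q x.
  move=> xst; rewrite -subr_ge0.
  have := mulr_ge0 (xw x xst) (sqr_ge0 (psi x + a * (x - m))).
  by congr (_ <= _); rewrite /Q /e /weight; ring.
apply: le_trans (ge_abscont st Be Qst Qe).
(* The boundary term is linear in [phi]; 2 |phi| <= 1 + phi^2 brings it to the form that the limit
   principle accepts. *)
have bd x : m - l <= x <= m + l ->
    `|B x| <= `|a| * l * (weight x + weight x * phi x ^+ 2).
  move=> xI; have wx := weight_ge0 xI.
  have -> : weight x + weight x * phi x ^+ 2 = weight x * (1 + phi x ^+ 2) by ring.
  rewrite /B !normrM normrN normrM (ger0_norm wx) (ger0_norm (ler0n _ 2)).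
  have -> : 2 * `|a| * `|x - m| * weight x * `|phi x| =
    `|a| * weight x * (`|x - m| * (2 * `|phi x|)) by ring.
  have -> : `|a| * l * (weight x * (1 + phi x ^+ 2)) =
    `|a| * weight x * (l * (1 + phi x ^+ 2)) by ring.
  apply: ler_wpM2l; first by rewrite mulr_ge0.
  apply: ler_pM; [exact: normr_ge0|by rewrite mulr_ge0| |].
    by rewrite ler_norml; move/andP : xI => [? ?]; apply/andP; split; lra.
  have := sqr_ge0 (1 - `|phi x|); rewrite -(real_normK (num_real (phi x))).
  by move=> H; rewrite -subr_ge0; move: H; congr (_ <= _); ring.
have := bd t; have := bd s; rewrite !ler_norml => Hs Ht.
have /andP[_ bs] : - (`|a| * l * (weight s + weight s * phi s ^+ 2)) <= B s <=
   `|a| * l * (weight s + weight s * phi s ^+ 2) by apply: Hs; apply/andP; split; lra.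
have /andP[bt _] : - (`|a| * l * (weight t + weight t * phi t ^+ 2)) <= B t <=
   `|a| * l * (weight t + weight t * phi t ^+ 2) by apply: Ht; apply/andP; split; lra.
by rewrite mulrDr opprD addrC lerB.
Qed.

(** The source of the unweighted bound on int phi^2. From ((x - m) w phi^2)' = (3 w - 2 l^2) phi^2 +
    2 (x - m) w phi psi, the cross term is absorbed by l^2 phi^2 and l^2 w psi^2 because (x - m)^2 w
    <= l^4. The boundary terms have a favourable sign at both ends. *)
Lemma square_moment_inequality :
  0 <= \int[mu]_(x in `]m - l, m + l[)
    (- l ^+ 2 * phi x ^+ 2 + (3 * (weight x * phi x ^+ 2)
     + l ^+ 2 * (weight x * psi x ^+ 2))).
Proof.
have l0 := l_gt0; set Q := (X in Rintegral _ _ X).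
have Qi : mu.-integrable `]m - l, m + l[ (EFin \o Q).
  apply: integrable_fctD => //; first exact: integrable_fctZ.
  apply: integrable_fctD => //; apply: integrable_fctZ => //.
  exact: integrable_abscontM (abscont_weight _ _) phi2_int.
apply: (@weight_limit_principle 0) => // s t ls sl lt_ tl.
rewrite mul0r oppr0; have st : s <= t by lra.
pose B x := (x - m) * (weight x * phi x ^+ 2).
pose e x := (l ^+ 2 - 3 * (x - m) ^+ 2) * phi x ^+ 2 +
   2 * (x - m) * weight x * phi x * psi x.
have Be : abscont s t B e.
  have P := abscont_sub_m s t; have W := abscont_weight s t.
  have F := dphi ls tl.
  have := abscontM P (abscontM W (abscontM F F)).
  by apply: eq_abscont => x _; rewrite /B /e /weight; ring.
have Qst := integrable_itv_sub ls tl Qi.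
have xw x : s <= x <= t -> 0 <= weight x by move=> /andP[? ?]; apply: weight_ge0; lra.
have Qe x : s <= x <= t -> e x <= Q x.
  move=> xst; rewrite -subr_ge0; have wx := xw x xst; have wl := weight_le x.
  have l2 : 0 < l ^+ 2 by rewrite exprn_gt0.
  have pl : (x - m) ^+ 2 <= l ^+ 2 by move: wx; rewrite /weight subr_ge0.
  rewrite -(pmulr_rge0 _ l2).
  have -> : l ^+ 2 * (Q x - e x) = (l ^+ 2 * phi x - (x - m) * weight x * psi x) ^+ 2
     + (l ^+ 2 * l ^+ 2 - (x - m) ^+ 2 * weight x) * (weight x * psi x ^+ 2).
    by rewrite /Q /e /weight; ring.
  apply: addr_ge0; first exact: sqr_ge0.
  apply: mulr_ge0; last by rewrite mulr_ge0// sqr_ge0.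
  by rewrite subr_ge0; apply: ler_pM => //; exact: sqr_ge0.
apply: le_trans (ge_abscont st Be Qst Qe).
have wt : 0 <= weight t * phi t ^+ 2 by rewrite mulr_ge0 ?sqr_ge0// xw// st lexx.
have ws : 0 <= weight s * phi s ^+ 2 by rewrite mulr_ge0 ?sqr_ge0// xw// st lexx.
rewrite subr_ge0 /B; apply: (@le_trans _ _ 0).
  by rewrite mulr_le0_ge0//; lra.
by rewrite mulr_ge0//; lra.
Qed.

End weighted_inequalities.

(** * Combination into the coercivity estimate *)

Section coercivity.
Set Implicit Arguments.
Unset Strict Implicit.
Context {R : realType}.
Local Notation mu := (@lebesgue_measure R).

(** The letters stand for N = int w^3 g^2, D = int w psi^2, P = int w phi^2, F = int phi^2, M = int
    phi, X = int w phi and c = phi m; the numbers 4/3 l^3 and 4/15 l^5 are the integrals of w and of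
    (x - m)^2 w. What remains is to eliminate c, X and P. *)
Lemma coercivity_arithmetic (l N D P F M X c : R) : 0 < l ->
  0 <= N - 4 * l ^+ 2 * D + 12 * l ^+ 2 * F - 9 * P ->
  0 <= l ^+ 2 * D - 11 / 4 * (P - 2 * c * X + c ^+ 2 * (4 / 3 * l ^+ 3)) ->
  (forall a, 0 <= D + (4 * a * l ^+ 2 * M - 6 * a * X + a ^+ 2 * (4 / 15 * l ^+ 5))) ->
  0 <= - l ^+ 2 * F + 3 * P + l ^+ 2 * D ->
  3 / 10 * l ^+ 2 * D + 2 * l * M ^+ 2 <=
    N + (12 * l ^+ 2 * F - 18 * P) + 8 * l * M ^+ 2 /\
  F <= 3 * D + 2 / l * M ^+ 2.
Proof.
move=> l0 H1 H2 H3 H4.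
have ln0 : l != 0 by rewrite gt_eqF.
have l2 : 0 < l ^+ 2 by rewrite exprn_gt0.
have l3 : 0 < l ^+ 3 by rewrite exprn_gt0.
pose J := 2 * l ^+ 2 * M - 3 * X.
have D0 : 0 <= D by move: (H3 0); rewrite !mulr0 !mul0r expr0n /= mul0r !subr0 !addr0.
(* The hypothesis reads D + 2 a J + (4/15) l^5 a^2 >= 0, and the chosen [a] is the minimiser of this
   quadratic. *)
have Z : J ^+ 2 / l ^+ 3 <= 4 / 15 * (l ^+ 2 * D).
  have := mulr_ge0 (ltW l2) (H3 (- (15 / 4) * J / l ^+ 5)).
  have -> : l ^+ 2 * (D + (4 * (- (15 / 4) * J / l ^+ 5) * l ^+ 2 * M -
     6 * (- (15 / 4) * J / l ^+ 5) * X +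
     (- (15 / 4) * J / l ^+ 5) ^+ 2 * (4 / 15 * l ^+ 5))) =
     l ^+ 2 * D - 15 / 4 * (J ^+ 2 / l ^+ 3) by rewrite /J; field.
  lra.
(* Since 3 X = 2 l^2 M - J, this is (A - J)^2 <= 2 A^2 + 2 J^2 with A = 2 l^2 M. *)
have Y : X ^+ 2 / l ^+ 3 * (3 / 4) <= 2 / 3 * (l * M ^+ 2) + 1 / 6 * (J ^+ 2 / l ^+ 3).
  rewrite -subr_ge0.
  have -> : 2 / 3 * (l * M ^+ 2) + 1 / 6 * (J ^+ 2 / l ^+ 3) -
    X ^+ 2 / l ^+ 3 * (3 / 4) = (2 * l ^+ 2 * M + J) ^+ 2 / l ^+ 3 / 12.
    by rewrite /J; field.
  by rewrite !divr_ge0// ?sqr_ge0// ltW.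
(* Maximising over c replaces the midpoint value by the weighted mean of phi, whatever c is. *)
have C : 2 * c * X - c ^+ 2 * (4 / 3 * l ^+ 3) <= X ^+ 2 / l ^+ 3 * (3 / 4).
  rewrite -subr_ge0.
  have -> : X ^+ 2 / l ^+ 3 * (3 / 4) - (2 * c * X - c ^+ 2 * (4 / 3 * l ^+ 3)) =
     l ^+ 3 * (c - X / l ^+ 3 * (3 / 4)) ^+ 2 * (4 / 3) by field.
  by apply: mulr_ge0; [apply: mulr_ge0; [exact: ltW|exact: sqr_ge0]|lra].
have lD : 0 <= l ^+ 2 * D by rewrite mulr_ge0// ltW.
have lM : 0 <= l * M ^+ 2 by rewrite mulr_ge0 ?sqr_ge0// ltW.
(* Here 4/11 is the Poincare constant and 2/45 = 1/6 * 4/15 comes from [Y] and [Z]. *)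
have hP : P <= 4 / 11 * (l ^+ 2 * D) + 2 / 3 * (l * M ^+ 2) + 2 / 45 * (l ^+ 2 * D).
  lra.
split; first lra.
rewrite -(ler_pM2l l2).
have -> : l ^+ 2 * (3 * D + 2 / l * M ^+ 2) =
  3 * (l ^+ 2 * D) + 2 * (l * M ^+ 2) by field.
lra.
Qed.

Context (m l : R) (l_gt0 : 0 < l).
Local Notation I := (`]m - l, m + l[%classic).
Local Notation w := (weight m l).

Lemma itv_ends_le : m - l <= m + l. Proof. by have := l_gt0; lra. Qed.

Lemma integrable_abscont_oo F f : abscont (m - l) (m + l) F f ->
  mu.-integrable I (EFin \o F).
Proof.
move=> Ff; apply: (@integrableS _ _ _ mu `[m - l, m + l]) => //.
  exact: subset_itv_oo_cc.
apply: continuous_compact_integrable; first exact: segment_compact.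
exact: abscont_continuous itv_ends_le Ff.
Qed.

Lemma Rintegral_abscont_oo F f : abscont (m - l) (m + l) F f ->
  \int[mu]_(x in I) f x = F (m + l) - F (m - l).
Proof.
move=> [fi ->//]; last exact: itv_ends_le.
have sub : I `<=` `[m - l, m + l] by exact: subset_itv_oo_cc.
rewrite Rintegral_itv_bndo_bndc; last exact: integrableS fi.
rewrite Rintegral_itv_obnd_cbnd//.
by apply: integrableS fi => //; apply: subset_itvr; rewrite bnd_simp.
Qed.

Lemma Rintegral_weight : \int[mu]_(x in I) w x = 4 / 3 * l ^+ 3.
Proof.
have P := abscont_sub_m m (m - l) (m + l).
have C k := abscont_cst (m - l) (m + l) (k : R).
have := abscontD (abscontM (C (l ^+ 2)) P)
  (abscontM (C (- (1 / 3))) (abscontM P (abscontM P P))).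
move=> H; rewrite (@Rintegral_abscont_oo
  (fun x => l ^+ 2 * (x - m) - 1 / 3 * (x - m) ^+ 3)); first by field.
by apply: eq_abscont H => x _; rewrite /weight; field.
Qed.

Lemma Rintegral_second_moment_weight :
  \int[mu]_(x in I) ((x - m) ^+ 2 * w x) = 4 / 15 * l ^+ 5.
Proof.
have P := abscont_sub_m m (m - l) (m + l).
have P2 := abscontM P P.
have C k := abscont_cst (m - l) (m + l) (k : R).
have := abscontD (abscontM (C (l ^+ 2 / 3)) (abscontM P P2))
  (abscontM (C (- (1 / 5))) (abscontM P (abscontM P2 P2))).
move=> H; rewrite (@Rintegral_abscont_oo
  (fun x => l ^+ 2 / 3 * (x - m) ^+ 3 - 1 / 5 * (x - m) ^+ 5)); first by field.
by apply: eq_abscont H => x _; rewrite /weight; field.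
Qed.

Context (phi psi g : R -> R).
Context (dphi : forall s t, m - l < s -> t < m + l -> abscont s t phi psi).
Context (dpsi : forall s t, m - l < s -> t < m + l -> abscont s t psi g).
Context (phi_int : mu.-integrable I (EFin \o phi)).
Context (phi2_int : mu.-integrable I (EFin \o (fun x => phi x ^+ 2))).
Context (psi2_int : mu.-integrable I (EFin \o (fun x => w x * psi x ^+ 2))).
Context (g2_int : mu.-integrable I (EFin \o (fun x => w x ^+ 3 * g x ^+ 2))).

Local Ltac integrable_linear :=
  by repeat first [exact: integrable_fctZ | apply: integrable_fctD => //].

(** The combination 12 l^2 F - 18 P is the integral of 6 (3 (x - m)^2 - l^2) phi^2, that is, the
    potential term divided by kappa^3; in the same normalisation eta is 8 l. *)
Lemma coercivity :
  let N := \int[mu]_(x in I) (w x ^+ 3 * g x ^+ 2) in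
  let D := \int[mu]_(x in I) (w x * psi x ^+ 2) in
  let P := \int[mu]_(x in I) (w x * phi x ^+ 2) in
  let F := \int[mu]_(x in I) (phi x ^+ 2) in
  let M := \int[mu]_(x in I) phi x in
  3 / 10 * l ^+ 2 * D + 2 * l * M ^+ 2 <=
    N + (12 * l ^+ 2 * F - 18 * P) + 8 * l * M ^+ 2 /\
  F <= 3 * D + 2 / l * M ^+ 2.
Proof.
move=> N D P F M; pose X := \int[mu]_(x in I) (w x * phi x).
have W := abscont_weight m l (m - l) (m + l).
have Pi := abscont_sub_m m (m - l) (m + l).
have wi := integrable_abscont_oo W.
have wphi_int := integrable_abscontM l_gt0 W phi_int.
have wphi2_int := integrable_abscontM l_gt0 W phi2_int.
have p2w_int := integrable_abscontM l_gt0 (abscontM Pi Pi) wi.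
have mI : measurable I by [].
apply: (@coercivity_arithmetic l N D P F M X (phi m)) => //.
- have := second_order_inequality l_gt0 dphi dpsi phi2_int psi2_int g2_int.
  rewrite RintegralD//; try integrable_linear.
  rewrite RintegralD//; try integrable_linear.
  rewrite RintegralD//; try integrable_linear.
  rewrite !RintegralZl//.
  by congr (_ <= _); rewrite /N /D /F /P; ring.
- have := weighted_poincare l_gt0 dphi phi_int phi2_int psi2_int.
  rewrite (@eq_Rintegral _ _ _ mu _ (fun x => l ^+ 2 * (w x * psi x ^+ 2) +
    (- (11 / 4) * (w x * phi x ^+ 2) + (11 / 2 * phi m * (w x * phi x) +
     - (11 / 4) * phi m ^+ 2 * w x)))); last by move=> x _; field.
  rewrite RintegralD//; try integrable_linear.
  rewrite RintegralD//; try integrable_linear.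
  rewrite RintegralD//; try integrable_linear.
  rewrite !RintegralZl// Rintegral_weight.
  by congr (_ <= _); rewrite /D /P /X; field.
- move=> a; have := first_moment_inequality l_gt0 dphi phi_int phi2_int psi2_int a.
  have p2w : mu.-integrable I (EFin \o (fun x => (x - m) ^+ 2 * w x)).
    by apply: eq_integrable p2w_int => // x _ /=; rewrite expr2.
  rewrite RintegralD//; try integrable_linear.
  rewrite RintegralD//; try integrable_linear.
  rewrite RintegralD//; try integrable_linear.
  rewrite !RintegralZl// Rintegral_second_moment_weight.
  by congr (_ <= _); rewrite /D /M /X; ring.
- have := square_moment_inequality l_gt0 dphi phi2_int psi2_int.
  rewrite RintegralD//; try integrable_linear.
  rewrite RintegralD//; try integrable_linear.
  rewrite !RintegralZl//.
  by congr (_ <= _); rewrite /D /F /P; ring.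
Qed.

End coercivity.

(** * Admissible functions *)

Section admissible_functions.
Set Implicit Arguments.
Unset Strict Implicit.
Context {R : realType}.
Local Notation mu := (@lebesgue_measure R).
Implicit Types (kappa um up s t x y : R) (F f g h phi Phi : R -> R).

Lemma is_derive_cubic (a b c d x : R) :
  is_derive x 1 (fun y => a + b * y + c * y ^+ 2 + d * y ^+ 3)
    (b + 2 * c * x + 3 * d * x ^+ 2).
Proof.
have dx := is_derive_id x (1 : R).
have dx2 := is_deriveM dx dx.
have dx3 := is_deriveM dx dx2.
have := is_deriveD (is_deriveD (is_deriveD (is_derive_cst a x (1 : R))
  (is_deriveZ b dx)) (is_deriveZ c dx2)) (is_deriveZ d dx3).
rewrite (_ : (fun y => _) = cst a + b *: id + c *: (id * id) +
    d *: (id * (id * id)) :> (R -> R)).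
  by move=> H; apply: is_derive_eq H _; rewrite !fctE /GRing.scale /=; ring.
by apply/funext => y; rewrite !fctE /GRing.scale /=; ring.
Qed.

Lemma derive1_cubic (a b c d : R) :
  derive1 (fun y => a + b * y + c * y ^+ 2 + d * y ^+ 3) =
  (fun y => b + (2 * c) * y + (3 * d) * y ^+ 2 + 0 * y ^+ 3).
Proof.
apply/funext => y; rewrite derive1E; have [_ ->] := is_derive_cubic a b c d y.
ring.
Qed.

(** In centred coordinates B = - 2 kappa^2 (y - m) w and q = kappa w, so [q] divides the numerator
    and the quotient is a quadratic polynomial. Expanding [B] in powers of y makes its higher
    derivatives a computation on coefficients. *)
Lemma V_itvE kappa (m l y : R) : kappa != 0 -> m - l < y < m + l ->
  V kappa (m - l) (m + l) y = 6 * kappa ^+ 3 * (2 * l ^+ 2 - 3 * weight m l y).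
Proof.
move=> k0 yI; rewrite /V ifT ?in_itv// /V_int.
have -> : B kappa (m - l) (m + l) = (fun y => 2 * kappa ^+ 2 * m * (l ^+ 2 - m ^+ 2) +
    - 2 * kappa ^+ 2 * (l ^+ 2 - 3 * m ^+ 2) * y +
    - 6 * kappa ^+ 2 * m * y ^+ 2 + 2 * kappa ^+ 2 * y ^+ 3).
  by apply/funext => x; rewrite /B; ring.
rewrite /derive1n /= !derive1_cubic.
have w0 : (y - (m - l)) * (m + l - y) != 0.
  by move/andP : yI => [y1 y2]; rewrite mulf_neq0// subr_eq0 gt_eqF.
rewrite /q /weight.
have -> : kappa * (y - (m - l)) * (m + l - y) =
  kappa * ((y - (m - l)) * (m + l - y)) by ring.
have -> : l ^+ 2 - (y - m) ^+ 2 = (y - (m - l)) * (m + l - y) by ring.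
by field; rewrite k0 andbT; move: w0; rewrite mulf_eq0 negb_or andbC.
Qed.

Lemma ae_Rintegral_eq (D : set R) f g : measurable D ->
  measurable_fun D f -> measurable_fun D g ->
  {ae mu, forall x, D x -> f x = g x} ->
  \int[mu]_(x in D) f x = \int[mu]_(x in D) g x.
Proof.
move=> mD mf mg fg; congr fine; apply: ae_eq_integral => //.
- exact/measurable_EFinP.
- exact/measurable_EFinP.
- by apply: (@filterS _ _ (ae_filter_ringOfSetsType mu) _ _ _ fg) => x /[apply] ->.
Qed.

Lemma ae_integrable (D : set R) f g : measurable D -> measurable_fun D g ->
  {ae mu, forall x, D x -> f x = g x} ->
  mu.-integrable D (EFin \o f) -> mu.-integrable D (EFin \o g).
Proof.
move=> mD mg fg /integrableP[/measurable_EFinP mf fi]; apply/integrableP; split.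
  exact/measurable_EFinP.
rewrite (_ : integral _ _ _ = \int[mu]_(x in D) `|(EFin \o f) x|)%E//.
apply: ae_eq_integral => //.
- by apply: measurableT_comp => //; exact/measurable_EFinP.
- by apply: measurableT_comp => //; exact/measurable_EFinP.
- by apply: (@filterS _ _ (ae_filter_ringOfSetsType mu) _ _ _ fg) => x /[apply] /= ->.
Qed.

Lemma ae_abscont s t F f g : abscont s t F f -> measurable_fun `[s, t] g ->
  {ae mu, forall x, `[s, t]%classic x -> f x = g x} -> abscont s t F g.
Proof.
move=> [fi Ff] mg fg; split; first exact: ae_integrable fg fi.
move=> x y sx xy yt; rewrite Ff//.
have sub : `[x, y] `<=` `[s, t] by apply: subset_itvScc; rewrite bnd_simp.
apply: ae_Rintegral_eq => //.
- by apply: measurable_funS sub _ => //; case/integrableP : fi => /measurable_EFinP.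
- exact: measurable_funS sub mg.
- apply: (@filterS _ _ (ae_filter_ringOfSetsType mu) _ _ _ fg) => z H /sub; exact: H.
Qed.

Lemma abscont_measurable um up F f :
  (forall s t, um < s -> t < up -> abscont s t F f) ->
  measurable_fun `]um, up[ F.
Proof.
move=> dF.
have -> : `]um, up[%classic = \bigcup_n `[um + n.+1%:R^-1, up - n.+1%:R^-1]%classic.
  apply/seteqP; split => x /=.
    rewrite in_itv/= => /andP[umx xup].
    have x1 : 0 < x - um by rewrite subr_gt0.
    have x2 : 0 < up - x by rewrite subr_gt0.
    near \oo => n; exists n => //=; rewrite in_itv/=; apply/andP; split.
      by rewrite -lerBrDl; near: n; exact: near_natS_gt0.
    by rewrite lerBrDr -lerBrDl; near: n; exact: near_natS_gt0.
  move=> [n _] /=; rewrite !in_itv/= => /andP[x1 x2].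
  have n0 : 0 < (n.+1%:R : R)^-1 by rewrite invr_gt0.
  by rewrite (lt_le_trans _ x1) ?ltrDl//= (le_lt_trans x2)// gtrBl.
apply/measurable_fun_bigcup => [n|n]; first exact: measurable_itv.
have n0 : 0 < (n.+1%:R : R)^-1 by rewrite invr_gt0.
have [st|ts] := leP (um + n.+1%:R^-1) (up - n.+1%:R^-1); last first.
  rewrite set_itv_ge ?bnd_simp -?ltNge//; exact: measurable_fun_set0.
apply: subspace_continuous_measurable_fun => //.
by apply: abscont_continuous st (dF _ _ _ _); rewrite ?ltrDl ?gtrBl.
Unshelve. all: by end_near. Qed.

Lemma L2_sqr um up f : L2 um up f ->
  mu.-integrable `]um, up[ (EFin \o (fun x => f x ^+ 2)).
Proof.
move=> /Lfun2_integrable_sqr H; apply/(@integrable_mkcond _ _ _ mu) => //.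
apply: eq_integrable H => // x _ /=; rewrite !patchE; case: ifPn => //.
by rewrite expr0n.
Qed.

Lemma L2_measurable um up f : L2 um up f -> measurable_fun `]um, up[ f.
Proof.
move=> /sub_Lfun_mfun; rewrite inE => mf.
apply/(measurable_restrictT _ _) => //.
Qed.

Lemma L2_integrable um up f : L2 um up f ->
  mu.-integrable `]um, up[ (EFin \o f).
Proof.
move=> fL; apply: (@le_integrable _ _ _ mu _ _ _
    (EFin \o (fun x => 1 + f x ^+ 2))) => //.
- by apply/measurable_EFinP; exact: L2_measurable.
- move=> x _; rewrite lee_fin (ger0_norm (_ : 0 <= 1 + f x ^+ 2)); last first.
    by rewrite addr_ge0// sqr_ge0.
  have := sqr_ge0 (1 - `|f x|); rewrite -(real_normK (num_real (f x))).
  by have := normr_ge0 (f x); nra.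
- by apply: integrable_fctD => //; [exact: integrable_cst_oo|exact: L2_sqr].
Qed.

Lemma test_function_derive1 um up phi :
  test_function um up phi -> test_function um up (derive1 phi).
Proof.
move=> [sphi cphi phiI].
have sub : closure [set x | derive1 phi x != 0] `<=` closure [set x | phi x != 0].
  apply: (@subset_trans _ (closure (closure [set x | phi x != 0]))).
    apply: closureS => x /= dx; apply: contrapT => nx.
    have : \forall y \near x, phi y = 0.
      have oc : open (~` closure [set x | phi x != 0]).
        exact/closed_openC/closed_closure.
      have := open_nbhs_nbhs (conj oc nx); apply: filterS => y ny.
      by apply/eqP; apply: contra_notT ny => /negP ny; apply: subset_closure; exact/negP.
    move=> /near_eq_derive H; move/eqP : dx; apply.
    by rewrite derive1E (H 1) derive_cst.
  exact: closed_closure.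
split.
- exact: smooth_derive1.
- by apply: subclosed_compact sub => //; exact: closed_closure.
- exact: subset_trans phiI.
Qed.

(** Applying the first representation to the test function phi' identifies the inner derivative in
    the second one with [Phi_y]. *)
Lemma admissible_weak_derivative kappa um up Phi Phi_y Phi_yy :
  admissible kappa um up Phi Phi_y Phi_yy ->
  weak_derivative um up Phi Phi_y /\ weak_derivative um up Phi_y Phi_yy.
Proof.
move=> [_ [_ H1] [_ H2] _ _]; split; first exact: H1.
move=> phi tphi; have := H2 _ tphi; have := H1 _ (test_function_derive1 tphi).
by rewrite /distr_deriv /distr_of => <- <-.
Qed.

Lemma q_weight kappa (m l y : R) :
  q kappa (m - l) (m + l) y = kappa * weight m l y.
Proof. by rewrite /q /weight; ring. Qed.

Lemma weight_gt0 (m l y : R) : m - l < y < m + l -> 0 < weight m l y.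
Proof.
move=> /andP[y1 y2]; have -> : weight m l y = (y - (m - l)) * (m + l - y).
  by rewrite /weight; ring.
by rewrite mulr_gt0// subr_gt0.
Qed.

Section fixed_profile.
Context (kappa m l : R) (kappa_gt0 : 0 < kappa) (l_gt0 : 0 < l).
Local Notation I := (`]m - l, m + l[%classic).
Local Notation w := (weight m l).

(** Squaring turns the half-integer power of [q], positive inside the interval, into an integer
    power; it serves for n = 1 and n = 3. *)
Lemma L2_powR_q f (n : nat) :
  L2 (m - l) (m + l) (fun y => q kappa (m - l) (m + l) y `^ (n%:R / 2) * f y) ->
  mu.-integrable I (EFin \o (fun y => w y ^+ n * f y ^+ 2)).
Proof.
move=> /L2_sqr H.
have := integrable_fctZ (kappa ^- n) (measurable_itv _) H.
apply: eq_integrable => // y; rewrite inE/= in_itv/= => yI; congr (_%:E).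
have w0 := weight_gt0 yI.
have kw0 : 0 <= kappa * w y by rewrite mulr_ge0// ltW.
have -> : (q kappa (m - l) (m + l) y `^ (n%:R / 2) * f y) ^+ 2 =
    (kappa * w y) ^+ n * f y ^+ 2.
  rewrite q_weight exprMn -[X in X * _](powR_mulrn _ (powR_ge0 _ _)) -powRrM.
  by rewrite divfK// powR_mulrn.
by rewrite exprMn !mulrA mulVf ?mul1r// expf_neq0// gt_eqF.
Qed.

Lemma admissible_coercivity (Phi Phi_y Phi_yy : R -> R) :
  admissible kappa (m - l) (m + l) Phi Phi_y Phi_yy ->
  let N := \int[mu]_(y in I) (q kappa (m - l) (m + l) y ^+ 3 * Phi_yy y ^+ 2) in
  let D := \int[mu]_(y in I) (q kappa (m - l) (m + l) y * Phi_y y ^+ 2) in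
  let E := \int[mu]_(y in I) (V kappa (m - l) (m + l) y * Phi y ^+ 2) in
  let F := \int[mu]_(y in I) (Phi y ^+ 2) in
  let M := \int[mu]_(y in I) Phi y in
  3 / 10 * kappa ^+ 2 * l ^+ 2 * D + 2 * kappa ^+ 3 * l * M ^+ 2 <=
    N + E + 8 * kappa ^+ 3 * l * M ^+ 2 /\
  F <= 3 / kappa * D + 2 / l * M ^+ 2.
Proof.
move=> adm N D E F M; have l0 := l_gt0; have k0 := kappa_gt0.
have [W1 W2] := admissible_weak_derivative adm.
have [Phi_L2 [Phi_y_loc _] [Phi_yy_loc _] H1 H2] := adm.
have ml : m - l < m + l by lra.
have Phi_loc : locally_integrable I Phi.
  apply: open_integrable_locally (L2_integrable Phi_L2); exact: itv_open.
have [psi dpsi psiE] := weak_derivative_abscont ml Phi_y_loc Phi_yy_loc W2.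
have [phi dphi0 phiE] := weak_derivative_abscont ml Phi_loc Phi_y_loc W1.
have mpsi := abscont_measurable dpsi; have mphi := abscont_measurable dphi0.
(* So far [phi] is a primitive of [Phi_y]. Replacing [Phi_y] by its absolutely continuous
   representative [psi] chains the two primitives, so that [psi] is at once the derivative of [phi]
   and a primitive of [Phi_yy]. *)
have dphi s t : m - l < s -> t < m + l -> abscont s t phi psi.
  move=> ls tl; have stI : `[s, t] `<=` I.
    move=> x /=; rewrite !in_itv/= => /andP[sx xt].
    by rewrite (lt_le_trans ls)//= (le_lt_trans xt).
  apply: ae_abscont (dphi0 s t ls tl) _ _.
    by apply: measurable_funS stI mpsi.
  by apply: (@filterS _ _ (ae_filter_ringOfSetsType mu) _ _ _ psiE) => x H /stI; exact: H.
have mI : measurable I by [].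
have mPhi := L2_measurable Phi_L2.
have mPhi_y : measurable_fun I Phi_y by case: Phi_y_loc.
have W := abscont_weight m l (m - l) (m + l).
have mw : measurable_fun I w.
  by have /measurable_EFinP := measurable_int _ (integrable_abscont_oo l_gt0 W).
have fae (h : R -> R -> R) f1 f2 : {ae mu, forall x, I x -> f1 x = f2 x} ->
    {ae mu, forall x, I x -> h x (f1 x) = h x (f2 x)}.
  move=> f12; apply: (@filterS _ _ (ae_filter_ringOfSetsType mu) _ _ _ f12).
  by move=> x /[apply] ->.
have msq (f : R -> R) : measurable_fun I f -> measurable_fun I (fun x => f x ^+ 2).
  by move=> mf; exact: measurable_funX.
have mwsq (f : R -> R) : measurable_fun I f -> measurable_fun I (fun x => w x * f x ^+ 2).
  by move=> mf; apply: measurable_funM => //; exact: msq.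
have Phi2i := L2_sqr Phi_L2.
have Phi_y2i : mu.-integrable I (EFin \o (fun y => w y * Phi_y y ^+ 2)).
  by apply: (@L2_powR_q Phi_y 1); exact: H1.
have g2i : mu.-integrable I (EFin \o (fun y => w y ^+ 3 * Phi_yy y ^+ 2)).
  by apply: (@L2_powR_q Phi_yy 3); exact: H2.
have phii := ae_integrable mI mphi phiE (L2_integrable Phi_L2).
have phi2i := ae_integrable mI (msq _ mphi) (fae (fun _ z => z ^+ 2) _ _ phiE) Phi2i.
have psi2i := ae_integrable mI (mwsq _ mpsi)
  (fae (fun x z => w x * z ^+ 2) _ _ psiE) Phi_y2i.
have wPhi2i := integrable_abscontM l_gt0 W Phi2i.
have /= := coercivity l_gt0 dphi dpsi phii phi2i psi2i g2i.
rewrite -(ae_Rintegral_eq mI mPhi mphi phiE) -/M.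
rewrite -(ae_Rintegral_eq mI (msq _ mPhi) (msq _ mphi)
  (fae (fun _ z => z ^+ 2) _ _ phiE)) -/F.
rewrite -(ae_Rintegral_eq mI (mwsq _ mPhi) (mwsq _ mphi)
  (fae (fun x z => w x * z ^+ 2) _ _ phiE)).
rewrite -(ae_Rintegral_eq mI (mwsq _ mPhi_y) (mwsq _ mpsi)
  (fae (fun x z => w x * z ^+ 2) _ _ psiE)).
set N' := (\int[mu]_(x in I) (w x ^+ 3 * _)).
set D' := (\int[mu]_(x in I) (w x * Phi_y x ^+ 2)).
set P' := (\int[mu]_(x in I) (w x * Phi x ^+ 2)).
have -> : N = kappa ^+ 3 * N'.
  rewrite /N /N' -RintegralZl//; apply: eq_Rintegral => y _.
  by rewrite q_weight exprMn mulrA.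
have -> : D = kappa * D'.
  rewrite /D /D' -RintegralZl//; apply: eq_Rintegral => y _.
  by rewrite q_weight mulrA.
have -> : E = 6 * kappa ^+ 3 * (2 * l ^+ 2 * F - 3 * P').
  rewrite /E /F /P'.
  rewrite (@eq_Rintegral _ _ _ mu _ (fun y => 12 * kappa ^+ 3 * l ^+ 2 * Phi y ^+ 2 +
    - (18 * kappa ^+ 3) * (w y * Phi y ^+ 2))); last first.
    move=> y; rewrite inE/= in_itv/= => yI.
    by rewrite V_itvE// ?gt_eqF//; ring.
  rewrite RintegralD//; [|exact: integrable_fctZ|exact: integrable_fctZ].
  by rewrite !RintegralZl//; ring.
have kn0 : kappa != 0 by rewrite gt_eqF.
move=> [h1 h2]; split.
  (* Everything scales by kappa^3; the first-order integral already contains one factor kappa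
     through [q], so its coefficient retains kappa^2. *)
  have := ler_wpM2l (ltW (exprn_gt0 3 k0)) h1.
  by congr (_ <= _); ring.
rewrite (_ : 3 / kappa * (kappa * D') = 3 * D')//.
by field.
Qed.

End fixed_profile.

End admissible_functions.

(** * The two estimates with constants uniform in the position of the interval *)

Theorem proposition2p3 (R : realType) (kappa L : R)
    (kappa_gt0 : 0 < kappa) (L_gt0 : 0 < L) :
  let mu := @lebesgue_measure R in
  let eta := 4 * kappa ^+ 3 * L in
  (exists c : R, 0 < c /\
    forall (um up : R) (Phi Phi_y Phi_yy : R -> R),
      um < up -> up - um = L ->
      admissible kappa um up Phi Phi_y Phi_yy ->
      \int[mu]_(y in `]um, up[) (q kappa um up y ^+ 3 * Phi_yy y ^+ 2)
      + \int[mu]_(y in `]um, up[) (V kappa um up y * Phi y ^+ 2)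
      + eta * (\int[mu]_(y in `]um, up[) Phi y) ^+ 2
      >= c * (\int[mu]_(y in `]um, up[) (q kappa um up y * Phi_y y ^+ 2)
              + (\int[mu]_(y in `]um, up[) Phi y) ^+ 2)) /\
  (exists C : R, 0 < C /\
    forall (um up : R) (Phi Phi_y Phi_yy : R -> R),
      um < up -> up - um = L ->
      admissible kappa um up Phi Phi_y Phi_yy ->
      \int[mu]_(y in `]um, up[) (Phi y ^+ 2)
      <= C * (\int[mu]_(y in `]um, up[) (q kappa um up y * Phi_y y ^+ 2)
              + (\int[mu]_(y in `]um, up[) Phi y) ^+ 2)).
Proof.
move=> mu eta; pose l := L / 2.
have l0 : 0 < l by rewrite divr_gt0.
(* Only the midpoint m depends on [um] and [up] separately; the constants obtained for the centred
   interval involve [kappa] and [l] alone. *)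
have center um up : up - um = L -> exists m, um = m - l /\ up = m + l.
  by move=> upL; exists ((um + up) / 2); rewrite /l -upL; split; field.
have D_ge0 um up f : 0 <= \int[mu]_(y in `]um, up[) (q kappa um up y * f y ^+ 2).
  apply: Rintegral_ge0 => y /=; rewrite in_itv/= => /andP[y1 y2].
  by rewrite mulr_ge0 ?sqr_ge0// /q !mulr_ge0 ?subr_ge0 ?(ltW y1) ?(ltW y2)// ltW.
split.
- have a0 : 0 < 3 / 10 * kappa ^+ 2 * l ^+ 2.
    by rewrite !mulr_gt0// ?exprn_gt0//; lra.
  have b0 : 0 < 2 * kappa ^+ 3 * l by rewrite !mulr_gt0// exprn_gt0.
  pose c := Num.min (3 / 10 * kappa ^+ 2 * l ^+ 2) (2 * kappa ^+ 3 * l).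
  exists c; split; first by rewrite lt_min a0 b0.
  move=> um up Phi Phi_y Phi_yy _ /center[m [-> ->]] adm.
  have D0 := D_ge0 (m - l) (m + l) Phi_y.
  have [+ _] := admissible_coercivity kappa_gt0 l0 adm.
  have -> : eta = 8 * kappa ^+ 3 * l by rewrite /eta /l; field.
  apply: le_trans; rewrite mulrDr; apply: lerD; apply: ler_wpM2r => //.
  + by rewrite ge_min lexx.
  + exact: sqr_ge0.
  + by rewrite ge_min lexx orbT.
- have a0 : 0 < 3 / kappa by rewrite divr_gt0.
  have b0 : 0 < 2 / l by rewrite divr_gt0.
  exists (3 / kappa + 2 / l); split; first by rewrite addr_gt0.
  move=> um up Phi Phi_y Phi_yy _ /center[m [-> ->]] adm.
  have D0 := D_ge0 (m - l) (m + l) Phi_y.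
  have [_] := admissible_coercivity kappa_gt0 l0 adm.
  move=> /le_trans; apply; rewrite mulrDr; apply: lerD; apply: ler_wpM2r => //.
  + by rewrite lerDl ltW.
  + exact: sqr_ge0.
  + by rewrite lerDr ltW.
Qed.
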